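(* Let $\mathbf{W}=\hat{\mathbf{F}}^{*}\mathbf{T}\hat{\mathbf{G}}^{H}$ be the MRC/MRT relay precoder built from the MMSE channel estimates $\hat{\mathbf F},\hat{\mathbf G}$ (see context), let the number $N$ of receive (and of transmit) antennas at the relay be finite, and let $k\in\{1,\dots,2K\}$. Then the ergodic achievable rate $\mathbb{E}[\log_2(1+\mathrm{SNR}_k)]$ of user $S_k$ is lower bounded by $\log_2\{1+\mathrm{SNR}_k^{\mathrm{mrc}}\}$, i.e. $$\mathbb{E}\left[\log_2(1+\mathrm{SNR}_k)\right]\ \ge\ \log_2\left(1+\mathrm{SNR}_k^{\mathrm{mrc}}\right),$$ where $$\mathrm{SNR}_k^{\mathrm{mrc}}=\frac{a_k\,p_{k'}}{\sum_{i=1}^{2K}\Big(b^{(1)}_{k,i}+b^{(2)}_{k,i}P_R^{-1}+\sum_{j\in U_k}p_jP_R^{-1}b^{(3)}_{k,i,j}\Big)p_i+c_kp_k+\Big(d_k^{(1)}+d_k^{(2)}P_R+d_k^{(3)}P_R^{-1}\Big)+\sum_{i\in U_k}p_i f_{k,i}(P_R)},$$ with $\hat\Phi=\sum_{i=1}^{K}\left(\hat\sigma_{g,2i-1}^2\hat\sigma_{f,2i}^2+\hat\sigma_{g,2i}^2\hat\sigma_{f,2i-1}^2\right)$, $a_k=N^2\hat\sigma_{f,k}^4\hat\sigma_{g,k'}^4$, $b^{(1)}_{k,i}=\hat\Phi\sigma_{f,k}^2\sigma_{g,i}^2+N\left(\sigma_{f,k}^2\hat\sigma_{g,i}^4\hat\sigma_{f,i'}^2+\sigma_{g,i}^2\hat\sigma_{f,k}^4\hat\sigma_{g,k'}^2\right)$,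 $b^{(2)}_{k,i}=\sigma_n^2\left(\hat\Phi\sigma_{g,i}^2+N\hat\sigma_{g,i}^4\hat\sigma_{f,i'}^2\right)$, $b^{(3)}_{k,i,j}=\sigma_{k,j}^2\left(\hat\Phi\sigma_{g,i}^2+N\hat\sigma_{g,i}^4\hat\sigma_{f,i'}^2\right)$, $c_k=-\left(\hat\Phi\hat\sigma_{f,k}^2\hat\sigma_{g,k}^2+N\left(\hat\sigma_{f,k}^4\hat\sigma_{g,k}^2\hat\sigma_{g,k'}^2+\hat\sigma_{f,k}^2\hat\sigma_{g,k}^4\hat\sigma_{f,k'}^2\right)\right)$, $d_k^{(1)}=\left(\sigma_{LIR}^2\sigma_n^2+\sigma_{nr}^2\sigma_{f,k}^2\right)\hat\Phi+N\sigma_{nr}^2\hat\sigma_{f,k}^4\hat\sigma_{g,k'}^2$, $d_k^{(2)}=\sigma_{LIR}^2\left(\sigma_{f,k}^2\hat\Phi+N\hat\sigma_{f,k}^4\hat\sigma_{g,k'}^2\right)$, $d_k^{(3)}=\sigma_{nr}^2\sigma_n^2\hat\Phi$, $f_{k,i}(P_R)=P_R^{-1}e^{(1)}_{k,i}+e^{(2)}_{k,i}$, $e^{(1)}_{k,i}=\sigma_{nr}^2\sigma_{k,i}^2\hat\Phi$, $e^{(2)}_{k,i}=\sigma_{LIR}^2\sigma_{k,i}^2\hat\Phi$.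
   Context: Setting. $K\ge1$ user pairs $(S_{2m-1},S_{2m})$, $m=1,\dots,K$, exchange data through a full-duplex relay with $N$ transmit and $N$ receive antennas. For $k\in\{1,\dots,2K\}$, $k'$ denotes the partner index: $(k,k')=(2m-1,2m)$ or $(2m,2m-1)$. $U_k=\{1,3,\dots,2K-1\}$ for odd $k$ and $U_k=\{2,4,\dots,2K\}$ for even $k$ (so $k\in U_k$). $p_k\ge0$ is the transmit power of user $S_k$, $P_R>0$ the relay transmit power, $\mathbf{P}=\mathrm{diag}(\sqrt{p_1},\dots,\sqrt{p_{2K}})$. $(\cdot)^*,(\cdot)^T,(\cdot)^H$ denote conjugate, transpose and conjugate transpose. Channels. $\mathbf{G}=[\mathbf g_1,\dots,\mathbf g_{2K}]$ and $\mathbf{F}=[\mathbf f_1,\dots,\mathbf f_{2K}]$ are random matrices in $\mathbb{C}^{N\times 2K}$ with independent entries, those in column $k$ being $\mathcal{CN}(0,\sigma_{g,k}^2)$ and $\mathcal{CN}(0,\sigma_{f,k}^2)$ respectively. $\mathbf{G}_{RR}\in\mathbb{C}^{N\times N}$ (relay self-loop channel) has i.i.d. $\mathcal{CN}(0,\sigma_{LIR}^2)$ entries. $\sigma_{k,i}^2$, $i\in U_k$, is the variance of the zero-mean complex Gaussian self-loop ($i=k$) or inter-user ($i\ne k$) interference channel from user $S_i$ to user $S_k$. $\sigma_{nr}^2$ and $\sigma_n^2$ are the variances of the white Gaussian noise at the relay (per antenna) and at each user. Channel estimates. $\mathbf G=\hat{\mathbf G}+\mathbf E_g$, $\mathbf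 F=\hat{\mathbf F}+\mathbf E_f$, where $\hat{\mathbf G},\hat{\mathbf F},\mathbf E_g,\mathbf E_f,\mathbf G_{RR}$ are mutually independent, all with independent zero-mean circularly-symmetric complex Gaussian entries; entries in column $k$ of $\hat{\mathbf G},\hat{\mathbf F},\mathbf E_g,\mathbf E_f$ have variances $\hat\sigma_{g,k}^2=\frac{\tau P_\rho\sigma_{g,k}^4}{\tau P_\rho\sigma_{g,k}^2+1}$, $\hat\sigma_{f,k}^2=\frac{\tau P_\rho\sigma_{f,k}^4}{\tau P_\rho\sigma_{f,k}^2+1}$, $\sigma_{\xi,g,k}^2=\sigma_{g,k}^2-\hat\sigma_{g,k}^2$, $\sigma_{\xi,f,k}^2=\sigma_{f,k}^2-\hat\sigma_{f,k}^2$, respectively, where $\tau\ge 2K$ is the pilot length and $P_\rho>0$ the pilot power. $\hat{\mathbf f}_k,\hat{\mathbf g}_k$ are the $k$th columns of $\hat{\mathbf F},\hat{\mathbf G}$. Notation: $\sigma^4=(\sigma^2)^2$. Precoder. $\mathbf T=\mathrm{blkdiag}(\mathbf T_1,\dots,\mathbf T_K)\in\mathbb{R}^{2K\times2K}$ with each $\mathbf T_m=\begin{bmatrix}0&1\\1&0\end{bmatrix}$. The scaling constant is $$\alpha=\sqrt{\frac{P_R}{\mathbb{E}[\|\mathbf W\mathbf G\mathbf P\mathbf x\|^2]+\mathbb{E}[\|\mathbf W\mathbf G_{RR}\tilde{\mathbf x}_R\|^2]+\mathbb{E}[\|\mathbf W\mathbf z_R\|^2]}},$$ where $\mathbf x\in\mathbb{C}^{2K}$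 (user data) satisfies $\mathbb{E}[\mathbf x\mathbf x^H]=\mathbf I_{2K}$, $\tilde{\mathbf x}_R\in\mathbb{C}^N$ (residual self-loop interference) is zero-mean Gaussian with $\mathbb{E}[\tilde{\mathbf x}_R\tilde{\mathbf x}_R^H]=\frac{P_R}{N}\mathbf I_N$, $\mathbf z_R\sim\mathcal{CN}(\mathbf 0,\sigma_{nr}^2\mathbf I_N)$, and these are independent of each other and of all channels and estimates. Instantaneous SNR. With $\lambda_k=\mathbf f_k^T\mathbf W\mathbf g_k-\hat{\mathbf f}_k^T\mathbf W\hat{\mathbf g}_k$, $$\mathrm{SNR}_k=\frac{p_{k'}|\mathbf f_k^T\mathbf W\mathbf g_{k'}|^2}{p_k|\lambda_k|^2+\sum_{i\ne k,k'}p_i|\mathbf f_k^T\mathbf W\mathbf g_i|^2+\|\mathbf f_k^T\mathbf W\mathbf G_{RR}\|^2\frac{P_R}{N}+\|\mathbf f_k^T\mathbf W\|^2\sigma_{nr}^2+\frac{1}{\alpha^2}\sum_{i\in U_k}\sigma_{k,i}^2p_i+\frac{1}{\alpha^2}\sigma_n^2}.$$ The ergodic achievable rate of user $S_k$ is $\mathbb{E}[\log_2(1+\mathrm{SNR}_k)]$, expectation over all channels and estimates. *)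

(* Defs.v *)
From HB Require Import structures.
From mathcomp Require Export all_boot all_order all_algebra.
From mathcomp Require Export complex.
From mathcomp Require Export all_classical all_reals all_analysis.
Set Implicit Arguments.
Unset Strict Implicit.
Unset Printing Implicit Defensive.
Import Order.TTheory GRing.Theory Num.Theory.
Import numFieldNormedType.Exports.
Local Open Scope classical_set_scope.
Local Open Scope ring_scope.
Local Open Scope complex_scope.

Section ComplexMatrices.
Context {R : realType}.

Definition conj_mx m n (A : 'M[R[i]]_(m, n)) : 'M[R[i]]_(m, n) :=
  map_mx (fun z => z^*) A.

Definition herm_mx m n (A : 'M[R[i]]_(m, n)) : 'M[R[i]]_(n, m) :=
  (conj_mx A)^T.

Definition abs2 (z : R[i]) : R := complex.Re z ^+ 2 + complex.Im z ^+ 2.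

(* Squared Euclidean norm, used on row and column vectors. *)
Definition norm2 m n (A : 'M[R[i]]_(m, n)) : R :=
  \sum_(i < m) \sum_(j < n) abs2 (A i j).

Definition log2 (x : R) : R := ln x / ln 2.

End ComplexMatrices.

Section ComplexProbability.
Context {R : realType} {d : measure_display} {T : measurableType d}.
Variable P : probability T R.

Definition cmeasurable (Z : T -> R[i]) : Prop :=
  measurable_fun setT (fun w => complex.Re (Z w)) /\
  measurable_fun setT (fun w => complex.Im (Z w)).

Definition cmeasurable_mx m n (X : T -> 'M[R[i]]_(m, n)) : Prop :=
  forall i j, cmeasurable (fun w => X w i j).

Definition sigma_of (J : Type) (Z : J -> T -> R[i]) : set (set T) :=
  <<s [set A | exists (j : J) (B : set R), measurable B /\
        (A = (fun w => complex.Re (Z j w)) @^-1` B \/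
         A = (fun w => complex.Im (Z j w)) @^-1` B)] >>.

Definition sigma_mx m n (X : T -> 'M[R[i]]_(m, n)) : set (set T) :=
  sigma_of (fun (ij : 'I_m * 'I_n) w => X w ij.1 ij.2).

(* Mutual independence of a family of classes of events. *)
Definition mutual_indep (I : eqType) (F : I -> set (set T)) : Prop :=
  forall (s : seq I) (E : I -> set T), uniq s ->
    (forall i, i \in s -> F i (E i)) ->
    P (\big[setI/setT]_(i <- s) E i) = (\prod_(i <- s) P (E i))%E.

(* X ~ N(0, v). The case v = 0 is the Dirac mass at 0: the library's
   [normal_prob m 0] is not that law but the uniform one on [0, 1]. *)
Definition gaussian (X : T -> R) (v : R) : Prop :=
  measurable_fun setT X /\
  forall B : set R, measurable B ->
    P (X @^-1` B) =
      if v == 0 then \d_(0 : R) B else normal_prob 0 (Num.sqrt v) B.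

(* Z ~ CN(0, v), circularly symmetric *)
Definition cgaussian (Z : T -> R[i]) (v : R) : Prop :=
  [/\ gaussian (fun w => complex.Re (Z w)) (v / 2),
      gaussian (fun w => complex.Im (Z w)) (v / 2) &
      forall A B : set R, measurable A -> measurable B ->
        P ((fun w => complex.Re (Z w)) @^-1` A `&`
           (fun w => complex.Im (Z w)) @^-1` B) =
        (P ((fun w => complex.Re (Z w)) @^-1` A) *
         P ((fun w => complex.Im (Z w)) @^-1` B))%E].

(* Independent entries, the (i, j) one being CN(0, v j). *)
Definition cgaussian_mx m n (X : T -> 'M[R[i]]_(m, n)) (v : 'I_n -> R) : Prop :=
  (forall i j, cgaussian (fun w => X w i j) (v j)) /\
  mutual_indep (fun ij : 'I_m * 'I_n =>
    sigma_of (fun (_ : unit) w => X w ij.1 ij.2)).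

(* Zero-mean, jointly Gaussian, of arbitrary covariance and
   pseudo-covariance: all real-linear functionals are Gaussian. *)
Definition gaussian_vec n (X : T -> 'cV[R[i]]_n) : Prop :=
  forall c : 'rV[R[i]]_n, exists v : R, 0 <= v /\
    gaussian (fun w => complex.Re ((c *m X w) 0 0)) v.

Definition cexpectation (Z : T -> R[i]) : R[i] :=
  fine ('E_P[fun w => complex.Re (Z w)])%E +i*
  fine ('E_P[fun w => complex.Im (Z w)])%E.

(* E[X X^H] *)
Definition correlation_mx n (X : T -> 'cV[R[i]]_n) : 'M[R[i]]_n :=
  \matrix_(i, j) cexpectation (fun w => (X w *m herm_mx (X w)) i j).

End ComplexProbability.

(* User S_k, k = 1, ..., 2K, is the index k - 1 : 'I_(K.*2); pair number m
   (from 0) consists of the indices 2m and 2m + 1. *)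
Section Users.
Variable K : nat.

Lemma fst_user_subproof (m : 'I_K) : (m.*2 < K.*2)%N.
Proof. by rewrite ltn_double. Qed.

Lemma snd_user_subproof (m : 'I_K) : (m.*2.+1 < K.*2)%N.
Proof. by rewrite ltn_Sdouble. Qed.

Definition fst_user (m : 'I_K) : 'I_(K.*2) := Ordinal (fst_user_subproof m).
Definition snd_user (m : 'I_K) : 'I_(K.*2) := Ordinal (snd_user_subproof m).

Lemma partner_subproof (k : 'I_(K.*2)) :
  ((if odd k then k.-1 else k.+1) < K.*2)%N.
Proof.
case: ifP => ok; first exact: leq_ltn_trans (leq_pred k) (ltn_ord k).
by rewrite ltn_neqAle ltn_ord andbT; apply/eqP => e; move: (odd_double K);
  rewrite -e /= ok.
Qed.

Definition partner (k : 'I_(K.*2)) : 'I_(K.*2) := Ordinal (partner_subproof k).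

(* i \in U_k *)
Definition in_U (k i : 'I_(K.*2)) : bool := odd i == odd k.

End Users.

(* The fields var_* are the variances sigma^2 themselves. *)
Record relay_params (R : realType) (K : nat) := RelayParams {
  pow : 'I_(K.*2) -> R;                       (* p_k *)
  pow_R : R;                                  (* P_R *)
  var_g : 'I_(K.*2) -> R;
  var_f : 'I_(K.*2) -> R;
  var_LIR : R;
  var_iui : 'I_(K.*2) -> 'I_(K.*2) -> R;      (* sigma_{k,i}^2 *)
  var_nr : R;
  var_n : R;
  tau : nat;
  pow_rho : R                                 (* P_rho *)
}.

Record relay_rvs (R : realType) (K N : nat) (T : Type) := RelayRvs {
  Ghat : T -> 'M[R[i]]_(N, K.*2);
  Fhat : T -> 'M[R[i]]_(N, K.*2);
  Eg : T -> 'M[R[i]]_(N, K.*2);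
  Ef : T -> 'M[R[i]]_(N, K.*2);
  GRR : T -> 'M[R[i]]_N;
  xU : T -> 'cV[R[i]]_(K.*2);                 (* user data x *)
  xR : T -> 'cV[R[i]]_N;                      (* residual self-loop signal *)
  zR : T -> 'cV[R[i]]_N                       (* relay noise *)
}.

Section Estimation.
Context {R : realType} {K : nat}.
Variable c : relay_params R K.

Definition var_mmse (v : R) : R :=
  (tau c)%:R * pow_rho c * v ^+ 2 / ((tau c)%:R * pow_rho c * v + 1).

Definition var_ghat k : R := var_mmse (var_g c k).
Definition var_fhat k : R := var_mmse (var_f c k).
Definition var_eg k : R := var_g c k - var_ghat k.
Definition var_ef k : R := var_f c k - var_fhat k.

End Estimation.

Section InstantaneousSNR.
Context {R : realType} {K N : nat} {d : measure_display} {T : measurableType d}.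
Variables (P : probability T R) (c : relay_params R K) (S : relay_rvs R K N T).

Definition G (w : T) : 'M[R[i]]_(N, K.*2) := Ghat S w + Eg S w.
Definition F (w : T) : 'M[R[i]]_(N, K.*2) := Fhat S w + Ef S w.

Definition exchange_mx : 'M[R[i]]_2 := \matrix_(a, b) (a != b)%:R.

(* blkdiag(T_1, ..., T_K): the block of i is i./2, its position there odd i. *)
Definition Tmx : 'M[R[i]]_(K.*2) :=
  \matrix_(i, j) (if (i./2 == j./2)%N
                  then exchange_mx (inord (odd i)) (inord (odd j)) else 0).

Definition W (w : T) : 'M[R[i]]_N :=
  conj_mx (Fhat S w) *m Tmx *m herm_mx (Ghat S w).

Definition Pmx : 'M[R[i]]_(K.*2) := diag_mx (\row_k (Num.sqrt (pow c k))%:C).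

Definition alpha : R :=
  Num.sqrt (pow_R c /
    fine ('E_P[fun w => norm2 (W w *m G w *m Pmx *m xU S w)] +
          'E_P[fun w => norm2 (W w *m GRR S w *m xR S w)] +
          'E_P[fun w => norm2 (W w *m zR S w)])%E).

Definition lambda k (w : T) : R[i] :=
  ((col k (F w))^T *m W w *m col k (G w)) 0 0 -
  ((col k (Fhat S w))^T *m W w *m col k (Ghat S w)) 0 0.

Definition SNR (k : 'I_(K.*2)) (w : T) : R :=
  pow c (partner k) *
    abs2 (((col k (F w))^T *m W w *m col (partner k) (G w)) 0 0) /
  (pow c k * abs2 (lambda k w)
   + \sum_(i | (i != k) && (i != partner k))
       pow c i * abs2 (((col k (F w))^T *m W w *m col i (G w)) 0 0)
   + norm2 ((col k (F w))^T *m W w *m GRR S w) * (pow_R c / N%:R)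
   + norm2 ((col k (F w))^T *m W w) * var_nr c
   + 1 / alpha ^+ 2 * \sum_(i | in_U k i) var_iui c k i * pow c i
   + 1 / alpha ^+ 2 * var_n c).

Definition ergodic_rate (k : 'I_(K.*2)) : \bar R :=
  ('E_P[fun w => log2 (1 + SNR k w)])%E.

End InstantaneousSNR.

Section ClosedFormSNR.
Context {R : realType} {K : nat}.
Variables (c : relay_params R K) (N : nat).

Local Notation sg := (var_g c).
Local Notation sf := (var_f c).
Local Notation hg := (var_ghat c).
Local Notation hf := (var_fhat c).
Local Notation n := (N%:R : R).

Definition Phi : R :=
  \sum_(m < K) (hg (fst_user m) * hf (snd_user m) +
                hg (snd_user m) * hf (fst_user m)).

Definition a_ k : R := n ^+ 2 * hf k ^+ 2 * hg (partner k) ^+ 2.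

Definition b1_ k i : R :=
  Phi * sf k * sg i + n * (sf k * hg i ^+ 2 * hf (partner i) +
                           sg i * hf k ^+ 2 * hg (partner k)).

Definition b2_ (k i : 'I_(K.*2)) : R :=
  var_n c * (Phi * sg i + n * hg i ^+ 2 * hf (partner i)).

Definition b3_ k i j : R :=
  var_iui c k j * (Phi * sg i + n * hg i ^+ 2 * hf (partner i)).

Definition c_ k : R :=
  - (Phi * hf k * hg k +
     n * (hf k ^+ 2 * hg k * hg (partner k) +
          hf k * hg k ^+ 2 * hf (partner k))).

Definition d1_ k : R :=
  (var_LIR c * var_n c + var_nr c * sf k) * Phi +
  n * var_nr c * hf k ^+ 2 * hg (partner k).

Definition d2_ k : R :=
  var_LIR c * (sf k * Phi + n * hf k ^+ 2 * hg (partner k)).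

Definition d3_ (k : 'I_(K.*2)) : R := var_nr c * var_n c * Phi.

Definition e1_ k i : R := var_nr c * var_iui c k i * Phi.

Definition e2_ k i : R := var_LIR c * var_iui c k i * Phi.

Definition f_ k i (PR : R) : R := PR^-1 * e1_ k i + e2_ k i.

Definition SNR_mrc (k : 'I_(K.*2)) : R :=
  let PR := pow_R c in
  a_ k * pow c (partner k) /
  (\sum_(i < K.*2)
      (b1_ k i + b2_ k i * PR^-1 +
       \sum_(j | in_U k j) pow c j * PR^-1 * b3_ k i j) * pow c i
   + c_ k * pow c k
   + (d1_ k + d2_ k * PR + d3_ k * PR^-1)
   + \sum_(i | in_U k i) pow c i * f_ k i PR).

End ClosedFormSNR.

(* Main.v *)
(* Put h_i = f_k^T W g_i and let D be the denominator of SNR_k. For every real c,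
   |1 - c sqrt(p) h|^2 + c^2 D >= D / (D + p |h|^2) = 1 / (1 + SNR_k), where
   h = h_{k'} and p = p_{k'}; the left-hand side is the error of a scalar linear
   estimate. Choosing the c that minimizes its mean and using Jensen's inequality
   for -log gives
     E[log2(1 + SNR_k)] >= log2(1 + p |E h|^2 / (p Var h + E D)),
   and the right-hand side is exactly the claimed bound. To compute the moments,
   write h_i = sum_a u_a v_{a'} with u = F^^H f_k, v = G^^H g_i (F^, G^ the
   estimates): u and v are independent with uncorrelated entries, whose second
   moments follow from the second and fourth moments of the Gaussian entries.
   The terms of D and the powers in alpha are sums of the same bilinear form.
   If a_k p_{k'} = 0 the bound is 0; otherwise 1 / alpha^2 > 0, so D > 0. *)
Require Import Defs.
From mathcomp Require Import zify ring lra measurable_realfun.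
Import Order.TTheory GRing.Theory Num.Theory.
Import numFieldNormedType.Exports.
Local Open Scope classical_set_scope.
Local Open Scope ring_scope.
Local Open Scope complex_scope.
Set Implicit Arguments.
Unset Strict Implicit.
Unset Printing Implicit Defensive.

(* Inside products [^*] is parsed as [Num.conj], not as the [conjc] of Defs. *)
Local Notation "x ^@" := (conjc x) (at level 1, left associativity, format "x ^@").

(** * Integration against a density *)

(** The coefficient h_{k'} and the denominator D are dependent, as both are built from f_k and W, so
    the mean of log2(1 + SNR_k) does not split. The linear-estimate error is affine in Re h, |h|^2
    and D, and a tangent line of -log is affine in that error; hence only three means are needed,
    whatever the dependence.

    The entries of u are not independent either, since they share the column f_k. They are
    uncorrelated, and this is enough: u and v come from disjoint independent blocks, and only second
    moments of the bilinear form are required.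

    The negative coefficient c_k arises because the estimated self-interference has the same inner
    product with the true one as with itself, so E|lambda_k|^2 is a difference of two second
    moments.

    The data x and the residual signal x_R enter the powers in alpha only through their correlation
    matrices. Expectations are read through [fine], which sends infinity to 0, so the integrability
    of their squares must be extracted from the diagonal correlations being nonzero. *)

Section density.
Context d (T : measurableType d) (R : realType).
Variables (mu nu : {measure set T -> \bar R}) (g : T -> R).
Hypotheses (mg : measurable_fun setT g) (g0 : forall x, 0 <= g x).
Hypothesis nuE : forall A, measurable A -> nu A = (\int[mu]_(x in A) (g x)%:E)%E.
Import HBNNSimple.

Let integral_density_nnsfun (f : {nnsfun T >-> R}) :
  (\int[nu]_x (f x)%:E = \int[mu]_x ((f x)%:E * (g x)%:E))%E.
Proof.
under [LHS]eq_integral do rewrite fimfunE -fsumEFin//.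
rewrite [LHS]ge0_integral_fsum//; last 2 first.
  - by move=> r; exact/measurable_EFinP/measurableT_comp.
  - by move=> n x _; rewrite EFinM nnfun_muleindic_ge0.
under [RHS]eq_integral.
  move=> x _; rewrite fimfunE -fsumEFin// ge0_mule_fsuml; last first.
    by move=> r; rewrite EFinM nnfun_muleindic_ge0.
  over.
rewrite [RHS]ge0_integral_fsum//; last 2 first.
  - move=> r; apply: emeasurable_funM; last exact/measurable_EFinP.
    exact/measurable_EFinP/measurableT_comp.
  - by move=> n x _; rewrite mule_ge0 ?lee_fin// -lee_fin EFinM nnfun_muleindic_ge0.
apply: eq_fsbigr => r _.
have mA : measurable (f @^-1` [set r]) by exact: measurable_funPTI.
rewrite integralZl_indic_nnsfun// integral_indic// setIT nuE//.
under [RHS]eq_integral do rewrite EFinM -muleA.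
have mI : measurable_fun setT (fun x => (\1_(f @^-1` [set r]) x)%:E * (g x)%:E)%E.
  by apply: emeasurable_funM; exact/measurable_EFinP.
(* A negative value is never taken, so its preimage is empty and both sides vanish. *)
have [r0|r0] := leP 0 r; last first.
  rewrite preimage_nnfun0// integral_set0 mule0.
  by under eq_integral do rewrite indicE in_set0 mul0e mule0; rewrite integral0.
rewrite ge0_integralZl//; last by move=> x _; rewrite mule_ge0 ?lee_fin.
congr (_ * _)%E; rewrite integral_mkcond; apply: eq_integral => x _.
by rewrite patchE indicE; case: ifP => _; rewrite ?mul1e ?mul0e.
Qed.

Lemma ge0_integral_density (f : T -> R) : measurable_fun setT f ->
  (forall x, 0 <= f x) ->
  (\int[nu]_x (f x)%:E = \int[mu]_x (f x * g x)%:E)%E.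
Proof.
move=> mf f0.
have mf' : measurable_fun setT (EFin \o f) by exact/measurable_EFinP.
pose h := nnsfun_approx measurableT mf'.
have f0' x : setT x -> (0 <= (EFin \o f) x)%E by rewrite lee_fin.
have hf x : (EFin (h n x)) @[n --> \oo] --> (f x)%:E.
  exact: (cvg_nnsfun_approx measurableT mf' f0').
have hnd x : {homo (fun n => h n x) : a b / (a <= b)%N >-> a <= b}.
  by move=> a b ab; exact/lefP/nd_nnsfun_approx.
transitivity (limn (fun n => \int[nu]_x (h n x)%:E))%E.
  rewrite -monotone_convergence//.
  - by apply: eq_integral => x _; apply/esym/cvg_lim.
  - by move=> n; exact/measurable_EFinP.
  - by move=> n x _; rewrite lee_fin.
  - by move=> x _ a b ab; rewrite lee_fin hnd.
rewrite (_ : (fun n => _) = (fun n => \int[mu]_x ((h n x)%:E * (g x)%:E))%E); last first.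
  by apply/funext => n; exact: integral_density_nnsfun.
rewrite -monotone_convergence//.
- apply: eq_integral => x _; apply/cvg_lim => //; rewrite EFinM.
  exact: cvgeMr (hf x).
- by move=> n; apply: emeasurable_funM; exact/measurable_EFinP.
- by move=> n x _; rewrite mule_ge0 ?lee_fin.
- by move=> x _ a b ab; rewrite lee_wpmul2r ?lee_fin ?hnd.
Qed.

Lemma integrable_density (f : T -> R) : measurable_fun setT f ->
  mu.-integrable setT (fun x => (f x * g x)%:E) ->
  nu.-integrable setT (EFin \o f).
Proof.
move=> mf /integrableP[_ H]; apply/integrableP; split; first exact/measurable_EFinP.
apply: le_lt_trans H; rewrite le_eqVlt; apply/orP; left; apply/eqP.
rewrite (eq_integral (fun x => (`|f x|)%:E))// ge0_integral_density//; last first.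
  exact: measurableT_comp.
by apply: eq_integral => x _; rewrite /= normrM (ger0_norm (g0 x)).
Qed.

Lemma integral_density (f : T -> R) : measurable_fun setT f ->
  (\int[nu]_x (f x)%:E = \int[mu]_x (f x * g x)%:E)%E.
Proof.
move=> mf; rewrite integralE [RHS]integralE; congr (_ - _)%E.
- rewrite (eq_integral (fun x => (Num.max (f x) 0)%:E)); last first.
    by move=> x _; rewrite funeposE/= EFin_max.
  rewrite ge0_integral_density//; [|exact: measurable_funrpos|].
  + apply: eq_integral => x _; rewrite funeposE/= -EFin_max.
    by rewrite maxr_pMl// mul0r.
  + by move=> x; rewrite le_max lexx orbT.
- rewrite (eq_integral (fun x => (Num.max (- f x) 0)%:E)); last first.
    by move=> x _; rewrite funenegE/= EFin_max.
  rewrite ge0_integral_density//; [|exact: measurable_funrneg|].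
  + apply: eq_integral => x _; rewrite funenegE/= -EFin_max.
    by rewrite maxr_pMl// mul0r mulNr.
  + by move=> x; rewrite le_max lexx orbT.
Qed.
End density.

(** * Moments of the normal law *)

Section gaussian_moments.
Context {R : realType}.
Notation mu := (@lebesgue_measure R).

(** The fundamental theorem of calculus on growing symmetric intervals, then dominated convergence
    with bound |f|. Limits of F along the integers are enough for this. *)
Lemma integral_derive_eq0 (F f : R -> R) :
  (forall x, is_derive x (1 : R) F (f x)) -> continuous f ->
  mu.-integrable setT (EFin \o f) ->
  F n%:R @[n --> \oo] --> (0 : R) -> F (- n%:R) @[n --> \oo] --> (0 : R) ->
  (\int[mu]_x (f x)%:E = 0)%E.
Proof.
move=> dF cf intf Fp Fn.
have cF : continuous F.
  move=> x; apply: differentiable_continuous; apply/derivable1_diffP.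
  by have := dF x => -[].
(* The shift to [n.+1] keeps every interval nondegenerate. *)
pose D n : set R := `[- n.+1%:R, n.+1%:R]%classic.
pose f_ n : R -> \bar R := (EFin \o f) \_ (D n).
have intfn n : (\int[mu]_x f_ n x = (F n.+1%:R)%:E - (F (- n.+1%:R))%:E)%E.
  rewrite /f_ -integral_mkcond; apply: continuous_FTC2.
  - by rewrite (@lt_trans _ _ 0) ?oppr_lt0 ?ltr0n.
  - exact: continuous_subspaceT.
  - split.
    + by move=> x _; have := dF x => -[].
    + by apply: cvg_at_right_filter; exact: cF.
    + by apply: cvg_at_left_filter; exact: cF.
  - by move=> x _; rewrite derive1E; exact: derive_val.
have mf : measurable_fun setT (EFin \o f) by exact: measurable_int intf.
have [|||||_ _] := @dominated_convergence _ _ _ mu setT measurableT f_ (EFin \o f)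
    (abse \o (EFin \o f)).
- move=> n; apply/(measurable_restrictT _ _).1; first exact: measurable_itv.
  exact: measurable_funS mf.
- exact: mf.
- apply: aeW => x _; apply: cvg_near_cst.
  exists (Num.bound `|x|) => // n /= xn.
  rewrite /f_ patchE mem_set//= /D /= in_itv/=.
  rewrite -ler_norml (le_trans (ltW (archi_boundP _)))// ler_nat.
  exact: leq_trans xn (leqnSn _).
- exact: integrable_abse.
- apply: aeW => x n _; rewrite /f_ patchE; case: ifPn => // _.
  by rewrite abse0 abse_ge0.
move=> H.
apply: (cvg_unique _ H) => //.
rewrite (_ : [sequence _]_n = (fun n => (F n.+1%:R - F (- n.+1%:R))%:E)); last first.
  by apply/funext => n /=; rewrite intfn EFinB.
apply: cvg_EFin; first by near=> n.
rewrite /comp/= -[X in _ --> X]subr0.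
apply: cvgB; first by rewrite -(cvg_shiftS (fun n => F n%:R)) in Fp.
by rewrite -(cvg_shiftS (fun n => F (- n%:R))) in Fn.
Unshelve. all: by end_near. Qed.

Variable s : R.
Hypothesis s0 : s != 0.

Lemma is_derive_normal_pdf x :
  is_derive x (1 : R) (normal_pdf 0 s) (- x / s ^+ 2 * normal_pdf 0 s x).
Proof.
pose g (x : R) := - (s ^+ 2 *+ 2)^-1 * x ^+ 2.
have -> : normal_pdf 0 s = normal_peak s \*: (expR \o g).
  apply/funext => z; rewrite normal_pdfE// /normal_fun /g /= subr0 /GRing.scale/=.
  by congr (_ * expR _); ring.
have dg : is_derive x (1 : R) g (- (s ^+ 2 *+ 2)^-1 * (2 * x)).
  apply: is_derive_eq.
  by rewrite /GRing.scale/= ; ring.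
have de := @is_derive1_comp R expR g x _ _ (is_derive_expR (g x)) dg.
apply: is_derive_eq.
rewrite /GRing.scale/= -[X in _ = _ * X]/(normal_peak s * _).
rewrite -mulr_natr; field.
by rewrite s0.
Qed.

(** Keep only the term of degree k in the exponential series. *)
Lemma expr_le_expR (y : R) k : 0 <= y -> y ^+ k <= k`!%:R * expR y.
Proof.
move=> y0; case: k => [|k]; first by rewrite expr0 fact0 mul1r -expR0 ler_expR.
rewrite mulrC -ler_pdivrMr ?ltr0n ?fact_gt0//.
by apply: le_trans (expR_ge1Dxn k y0); rewrite lerDr.
Qed.

(** With y = x^2 / (4 s^2) the Gaussian exponent is -2y. One factor exp(-y) absorbs x^(2k) = (4
    s^2)^k y^k at the cost of k!; the other is, up to its peak, the normal density of variance 2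
    s^2. *)
Lemma even_pow_normal_pdf_le k : exists2 C : R, 0 <= C & forall x,
  x ^+ k.*2 * normal_pdf 0 s x <= C * normal_pdf 0 (s * Num.sqrt 2) x.
Proof.
have s20 : s * Num.sqrt 2 != 0 by rewrite mulf_neq0// gt_eqF// sqrtr_gt0.
exists (normal_peak s / normal_peak (s * Num.sqrt 2) * (4 * s ^+ 2) ^+ k * k`!%:R).
  by rewrite !mulr_ge0 ?invr_ge0 ?normal_peak_ge0 ?exprn_ge0// mulr_ge0// sqr_ge0.
move=> x; rewrite !normal_pdfE// /normal_fun subr0.
pose y := x ^+ 2 / (4 * s ^+ 2).
have s2 : s ^+ 2 != 0 by rewrite sqrf_eq0.
have y0 : 0 <= y by apply: divr_ge0; [|apply: mulr_ge0 => //]; exact: sqr_ge0.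
have -> : - x ^+ 2 / (s ^+ 2 *+ 2) = - y - y.
  by rewrite /y -mulr_natr; field.
have -> : - x ^+ 2 / ((s * Num.sqrt 2) ^+ 2 *+ 2) = - y.
  by rewrite /y exprMn sqr_sqrtr// -mulr_natr; field.
have -> : x ^+ k.*2 = (4 * s ^+ 2) ^+ k * y ^+ k.
  by rewrite -exprMn /y mulrC divfK ?mulf_neq0// -mul2n exprM.
have -> : normal_peak s / normal_peak (s * Num.sqrt 2) * (4 * s ^+ 2) ^+ k * k`!%:R *
  (normal_peak (s * Num.sqrt 2) * expR (- y)) =
  normal_peak s * (4 * s ^+ 2) ^+ k * expR (- y) * k`!%:R.
  by field; rewrite gt_eqF// normal_peak_gt0.
have -> : (4 * s ^+ 2) ^+ k * y ^+ k * (normal_peak s * expR (- y - y)) =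
  normal_peak s * (4 * s ^+ 2) ^+ k * expR (- y) * (y ^+ k * expR (- y)).
  by rewrite expRD; ring.
apply: ler_wpM2l.
  by rewrite !mulr_ge0 ?normal_peak_ge0 ?expR_ge0 ?exprn_ge0// mulr_ge0// sqr_ge0.
by rewrite -ler_pdivlMr ?expR_gt0// expRN invrK expr_le_expR.
Qed.

Lemma measurable_pow_normal_pdf k :
  measurable_fun setT (fun x : R => x ^+ k * normal_pdf 0 s x).
Proof. by apply: measurable_funM => //; exact: measurable_normal_pdf. Qed.

Lemma integrable_pow_normal_pdf k :
  mu.-integrable setT (fun x : R => (x ^+ k * normal_pdf 0 s x)%:E).
Proof.
have [C C0 HC] := even_pow_normal_pdf_le k.
(* Dominate |x|^k by 1 + x^(2k), which follows from (|x|^k - 1)^2 >= 0. *)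
apply: (@le_integrable _ _ _ mu setT measurableT
  (fun x : R => (x ^+ k * normal_pdf 0 s x)%:E)
  (fun x : R => ((normal_pdf 0 s x)%:E + C%:E * (normal_pdf 0 (s * Num.sqrt 2) x)%:E)%E)).
- by have /measurable_EFinP := measurable_pow_normal_pdf k.
- move=> x _; rewrite /= lee_fin [leRHS]ger0_norm; last first.
    apply: addr_ge0; first exact: normal_pdf_ge0.
    by apply: mulr_ge0 => //; exact: normal_pdf_ge0.
  rewrite normrM (ger0_norm (normal_pdf_ge0 _ _ _)) normrX.
  apply: (@le_trans _ _ ((1 + x ^+ k.*2) * normal_pdf 0 s x)); last first.
    by rewrite mulrDl mul1r lerD2l.
  apply: ler_wpM2r; first exact: normal_pdf_ge0.
  rewrite -muln2 mulnC exprM -(real_normK (num_real x)) -exprM mulnC exprM.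
  have : 0 <= (`|x| ^+ k - 1) ^+ 2 by rewrite sqr_ge0.
  have : 0 <= `|x| ^+ k by rewrite exprn_ge0.
  nra.
- apply: integrableD => //; first exact: integrable_normal_pdf.
  by apply: integrableZl => //; exact: integrable_normal_pdf.
Qed.

Lemma cvg_pow_normal_pdf k :
  n%:R ^+ k * normal_pdf 0 s n%:R @[n --> \oo] --> (0 : R).
Proof.
have [C C0 HC] := even_pow_normal_pdf_le k.+1.
have s20 : s * Num.sqrt 2 != 0 by rewrite mulf_neq0// gt_eqF// sqrtr_gt0.
(* Since n^(k+1) <= n^(2(k+1)), the bound at exponent k+1 leaves a spare factor 1/n in front of a
   bounded density. *)
pose M := C * normal_peak (s * Num.sqrt 2).
apply: (@squeeze_cvgr _ _ _ _ (cst 0) (fun n => M * n%:R^-1)).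
- near=> n; apply/andP; split; first by rewrite mulr_ge0 ?exprn_ge0 ?normal_pdf_ge0.
  have n0 : (0 < n)%N by near: n; exists 1%N.
  rewrite -ler_pdivrMr ?invr_gt0 ?ltr0n// invrK.
  apply: (@le_trans _ _ (n%:R ^+ k.+1.*2 * normal_pdf 0 s n%:R)); last first.
    apply: (le_trans (HC _)); apply: ler_wpM2l => //.
    exact: normal_pdf_ub.
  rewrite mulrAC; apply: ler_wpM2r; first exact: normal_pdf_ge0.
  rewrite -exprSr; apply: ler_weXn2l; last by rewrite -addnn leq_addr.
  by rewrite ler1n.
- exact: cvg_cst.
- rewrite -(mulr0 M); apply: cvgM; first exact: cvg_cst.
  by rewrite -(cvg_shiftS (fun n => n%:R^-1 : R)); exact: cvg_harmonic.
Unshelve. all: by end_near. Qed.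

(* x^k phi(x) has derivative k x^(k-1) phi(x) - x^(k+1) phi(x) / s^2. *)
Lemma normal_moment k :
  (\int[mu]_x (x ^+ k.+1 * normal_pdf 0 s x)%:E =
   (k%:R * s ^+ 2)%:E * \int[mu]_x (x ^+ k.-1 * normal_pdf 0 s x)%:E)%E.
Proof.
(* For k = 0 the truncated exponent [k.-1] is harmless, as its coefficient is 0. *)
pose f (x : R) := x ^+ k.+1 * normal_pdf 0 s x - k%:R * s ^+ 2 * (x ^+ k.-1 *
  normal_pdf 0 s x).
have fE x : (f x)%:E = ((x ^+ k.+1 * normal_pdf 0 s x)%:E -
    (k%:R * s ^+ 2)%:E * (x ^+ k.-1 * normal_pdf 0 s x)%:E)%E by [].
have i1 := integrable_pow_normal_pdf k.+1.
have i2 := integrable_pow_normal_pdf k.-1.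
have i3 : mu.-integrable setT (fun x => (k%:R * s ^+ 2)%:E * (x ^+ k.-1 * normal_pdf 0
  s x)%:E)%E.
  exact: integrableZl.
have : (\int[mu]_x (f x)%:E = 0)%E.
  apply: (@integral_derive_eq0 (fun x => - s ^+ 2 * (x ^+ k * normal_pdf 0 s x)) f).
  - move=> x; have dphi := is_derive_normal_pdf x.
    have dX := @is_deriveX R R id k x 1 1 (is_derive_id x 1).
    have dD := @is_deriveZ _ _ _ _ (- s ^+ 2) x 1 _ (is_deriveM dX dphi).
    rewrite (_ : (fun y => _) = - s ^+ 2 \*: (id ^+ k * normal_pdf 0 s)); last first.
      by apply/funext => y; rewrite /= fctE exprfctE.
    apply: (is_derive_eq dD); rewrite exprfctE /GRing.scale/= /f mulr1.
    rewrite /= (exprS x k). set p := normal_pdf 0 s x.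
    by field.
  - move=> x; apply: cvgB; [|apply: cvgM; first exact: cvg_cst].
      by apply: cvgM; [exact: exprn_continuous|exact: continuous_normal_pdf].
    by apply: cvgM; [exact: exprn_continuous|exact: continuous_normal_pdf].
  - exact: (integrableB measurableT i1 i3).
  - rewrite -[X in _ --> X](mulr0 (- s ^+ 2)); apply: cvgM; first exact: cvg_cst.
    exact: cvg_pow_normal_pdf.
  - rewrite -[X in _ --> X](mulr0 (- s ^+ 2 * (-1) ^+ k)).
    rewrite (_ : (fun n => _) = (fun n => - s ^+ 2 * (-1) ^+ k * (n%:R ^+ k *
      normal_pdf 0 s n%:R))).
      by apply: cvgM; [exact: cvg_cst|exact: cvg_pow_normal_pdf].
    apply/funext => n; rewrite (exprNn n%:R k) !normal_pdfE// /normal_fun !subr0 sqrrN.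
    by ring.
under eq_integral do rewrite fE.
rewrite integralB// integralZl// => /eqP.
rewrite sube_eq ?add0e; first by move/eqP.
  exact: integrable_fin_num.
by rewrite fin_num_adde_defl// -integralZl// integrable_fin_num.
Qed.
End gaussian_moments.

(** * Moments of Gaussian variables and means of independent products *)

Section gaussian_rv.
Context d (T : measurableType d) (R : realType) (P : probability T R).
Notation mu := (@lebesgue_measure R).

(** The integral is transported to the law of [X], which is a point mass when v = 0 and has the
    normal density otherwise. *)
Lemma gaussian_pow_integral (X : T -> R) (v : R) k : 0 <= v ->
  gaussian P X v ->
  P.-integrable setT (fun w => (X w ^+ k)%:E) /\
  (\int[P]_w (X w ^+ k)%:E = if v == 0%R then (0 ^+ k)%:E else
    \int[mu]_x (x ^+ k * normal_pdf 0 (Num.sqrt v) x)%:E)%E.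
Proof.
move=> v0 [mX PX].
have mX' : @measurable_fun _ _ T (measurableTypeR R) setT X by exact: mX.
pose X' : {mfun T >-> measurableTypeR R} := @mfun_Sub _ _ T (measurableTypeR R) X
  (mem_set mX').
pose nu := distribution P X'.
have mk : measurable_fun (setT : set (measurableTypeR R)) (EFin \o (fun x : R => x ^+ k)).
  by apply/measurable_EFinP; exact: exprn_measurable.
have intnu : nu.-integrable setT (EFin \o (fun x : R => x ^+ k)) /\
  (\int[nu]_x (x ^+ k)%:E = if v == 0%R then (0 ^+ k)%:E else
    \int[mu]_x (x ^+ k * normal_pdf 0 (Num.sqrt v) x)%:E)%E.
  have [v00|v00] := eqVneq v 0.
    pose delta : {measure set (measurableTypeR R) -> \bar R} :=
      @dirac _ (measurableTypeR R) (0 : R) R.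
    have nuE A : measurable A -> A `<=` setT -> nu A = delta A.
      by move=> mA _; rewrite /nu /distribution/= /pushforward PX// v00 eqxx.
    rewrite (eq_measure_integral delta nuE); split; last first.
      by rewrite integral_dirac// diracT mul1e.
    apply/integrableP; split => //.
    rewrite (eq_measure_integral delta nuE) integral_dirac//; last first.
      exact: measurableT_comp.
    by rewrite diracT mul1e ltry.
  have sv0 : Num.sqrt v != 0 by rewrite gt_eqF// sqrtr_gt0 lt_def v00.
  have nuE A : measurable A -> nu A = (\int[mu]_(x in A) (normal_pdf 0 (Num.sqrt v)
    x)%:E)%E.
    by move=> mA; rewrite /nu /distribution/= /pushforward PX// (negbTE v00).
  split.
    apply: (@integrable_density _ _ R mu nu (normal_pdf 0 (Num.sqrt v)) _ _ nuE (fun x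
      : R => x ^+ k)).
    - exact: measurable_normal_pdf.
    - exact: normal_pdf_ge0.
    - exact: exprn_measurable.
    - exact: integrable_pow_normal_pdf.
  apply: (@integral_density _ _ R mu nu (normal_pdf 0 (Num.sqrt v)) _ _ nuE (fun x : R
    => x ^+ k)).
  - exact: measurable_normal_pdf.
  - exact: normal_pdf_ge0.
  - exact: exprn_measurable.
have iX : P.-integrable setT (fun w => (X w ^+ k)%:E).
  have /integrableP[_ H] := intnu.1.
  apply/integrableP; split.
    by apply/measurable_EFinP; exact: measurable_funX.
  by rewrite ge0_integral_pushforward// in H; exact: measurableT_comp.
split => //; rewrite -intnu.2 integral_pushforward//.
Qed.

Lemma gaussian_moment1 (X : T -> R) (v : R) : 0 <= v -> gaussian P X v ->
  (\int[P]_w (X w)%:E = 0)%E.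
Proof.
move=> v0 gX; have [_] := gaussian_pow_integral 1 v0 gX.
under eq_integral do rewrite expr1; move=> ->.
have [//|v00] := eqVneq v 0.
have sv0 : Num.sqrt v != 0 by rewrite gt_eqF// sqrtr_gt0 lt_def v00.
by rewrite (normal_moment sv0 0) mul0r mul0e.
Qed.

Lemma gaussian_moment2 (X : T -> R) (v : R) : 0 <= v -> gaussian P X v ->
  (\int[P]_w (X w ^+ 2)%:E = v%:E)%E.
Proof.
move=> v0 gX; have [_ ->] := gaussian_pow_integral 2 v0 gX.
have [->|v00] := eqVneq v 0; first by rewrite expr0n.
have sv0 : Num.sqrt v != 0 by rewrite gt_eqF// sqrtr_gt0 lt_def v00.
rewrite (normal_moment sv0 1) mul1r sqr_sqrtr//.
under eq_integral do rewrite expr0 mul1r.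
by rewrite integral_normal_pdf mule1.
Qed.

Lemma gaussian_moment4 (X : T -> R) (v : R) : 0 <= v -> gaussian P X v ->
  (\int[P]_w (X w ^+ 4)%:E = (3 * v ^+ 2)%:E)%E.
Proof.
move=> v0 gX; have [_ ->] := gaussian_pow_integral 4 v0 gX.
have [->|v00] := eqVneq v 0; first by rewrite !expr0n mulr0.
have sv0 : Num.sqrt v != 0 by rewrite gt_eqF// sqrtr_gt0 lt_def v00.
rewrite (normal_moment sv0 3) (normal_moment sv0 1) mul1r sqr_sqrtr//.
under eq_integral do rewrite expr0 mul1r.
by rewrite integral_normal_pdf mule1 -EFinM -mulrA -expr2.
Qed.

(** Independence on rectangles identifies the joint law of (X, Y) with the product of the two laws;
    Tonelli then gives integrability and Fubini the factorization. *)
Lemma indep_integralM (X Y : T -> R) :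
  P.-integrable setT (EFin \o X) -> P.-integrable setT (EFin \o Y) ->
  (forall A B : set R, measurable A -> measurable B ->
    P (X @^-1` A `&` Y @^-1` B) = P (X @^-1` A) * P (Y @^-1` B))%E ->
  P.-integrable setT (fun w => (X w * Y w)%:E) /\
  (\int[P]_w (X w * Y w)%:E = \int[P]_w (X w)%:E * \int[P]_w (Y w)%:E)%E.
Proof.
move=> iX iY XY.
have mX : measurable_fun setT X by apply/measurable_EFinP; exact: measurable_int iX.
have mY : measurable_fun setT Y by apply/measurable_EFinP; exact: measurable_int iY.
have mXY : measurable_fun setT (fun w => (X w, Y w)) by exact: measurable_fun_pair.
pose X' : {mfun T >-> R} := mfun_Sub (mem_set mX).
pose Y' : {mfun T >-> R} := mfun_Sub (mem_set mY).
pose Z' : {mfun T >-> (R * R)%type} := mfun_Sub (mem_set mXY).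
pose mx : probability _ R := distribution P X'.
pose my : probability _ R := distribution P Y'.
pose mz : probability _ R := distribution P Z'.
have nuE A : measurable A -> A `<=` setT -> mz A = (mx \x my)%E A.
  move=> mA _; symmetry; exact: product_measure_unique.
pose f (z : R * R) := (z.1 * z.2)%:E.
have mf : measurable_fun setT f.
  by apply/measurable_EFinP; apply: measurable_funM.
have mid : measurable_fun setT (EFin \o (idfun : R -> R)) by apply/measurable_EFinP;
  exact: measurable_id.
have ix : mx.-integrable setT (EFin \o (idfun : R -> R)).
  exact: (integrable_pushforward mX mid).
have iy : my.-integrable setT (EFin \o (idfun : R -> R)).
  exact: (integrable_pushforward mY mid).
have iprod : (mx \x my)%E.-integrable setT f.
  apply/integrable12ltyP => //.
  rewrite (eq_integral (fun x : R => (\int[my]_y `|y%:E|) * `|x%:E|)%E); last first.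
    move=> x _; rewrite muleC -ge0_integralZl//.
    - by apply: eq_integral => y _; rewrite /f /= normrM.
    - apply: measurableT_comp => //; exact: measurable_int iy.
  have /integrableP[mi ylt] := iy.
  have /integrableP[mi' xlt] := ix.
  rewrite ge0_integralZl//.
  - by rewrite lte_mul_pinfty// ?integral_ge0// ge0_fin_numE// integral_ge0.
  - exact: measurableT_comp.
  - exact: integral_ge0.
have iXY : P.-integrable setT (fun w => (X w * Y w)%:E).
  have /integrableP[_ H] := iprod.
  apply/integrableP; split; first by apply/measurable_EFinP; exact: measurable_funM.
  rewrite -(eq_measure_integral _ nuE) ge0_integral_pushforward// in H.
  exact: measurableT_comp.
split => //.
transitivity (\int[mz]_z f z)%E.
  by rewrite integral_pushforward.
rewrite (eq_measure_integral _ nuE) -(integral12_prod_meas1 iprod) /fubini_F.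
under eq_integral => x _ do (rewrite /f /=; under eq_integral do rewrite EFinM).
have iyf : (\int[my]_y y%:E)%E \is a fin_num by exact: integrable_fin_num iy.
transitivity (\int[mx]_x (x%:E * \int[my]_y y%:E))%E.
  by apply: eq_integral => x _; rewrite integralZl.
rewrite -(fineK iyf) integralZr//.
by congr (_ * _)%E; rewrite ?fineK// integral_pushforward.
Qed.
End gaussian_rv.

(** * Complex random variables *)

Section abs2.
Context {R : realType}.
Implicit Types z w : R[i].

Lemma abs2M z w : abs2 (z * w) = abs2 z * abs2 w.
Proof. by case: z w => [a b] [c e]; rewrite /abs2/=; ring. Qed.

Lemma abs2_conjc z : abs2 z^@ = abs2 z.
Proof. by case: z => a b; rewrite /abs2/= sqrrN. Qed.

Lemma abs2E z : (abs2 z)%:C = z * z^@.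
Proof. by case: z => a b; apply/eqP; rewrite eq_complex/= /abs2/=; apply/andP; split;
  apply/eqP; ring. Qed.

Lemma conjcM z w : (z * w)^@ = z^@ * w^@.
Proof. exact: rmorphM. Qed.

Lemma conjcD z w : (z + w)^@ = z^@ + w^@.
Proof. exact: raddfD. Qed.

Lemma conjc_invol z : z^@^@ = z.
Proof. by case: z => a b; rewrite /= opprK. Qed.

Lemma natrC n : n%:R = (n%:R : R)%:C.
Proof. by rewrite (rmorph_nat (real_complex R)). Qed.

Lemma realCM (a b : R) : (a * b)%:C = a%:C * b%:C.
Proof. exact: (rmorphM (real_complex R)). Qed.

Lemma realCD (a b : R) : (a + b)%:C = a%:C + b%:C.
Proof. exact: (rmorphD (real_complex R)). Qed.

Lemma abs2_ge0 z : 0 <= abs2 z.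
Proof. by rewrite addr_ge0 ?sqr_ge0. Qed.

Lemma abs2D_le z w : abs2 (z + w) <= 2 * (abs2 z + abs2 w).
Proof.
case: z w => [a b] [c e]; rewrite /abs2/=.
have := sqr_ge0 (a - c); have := sqr_ge0 (b - e); nra.
Qed.

(** From |a| <= 1 + a^2; it turns integrability of |z|^2 into that of the real part. *)
Lemma normr_Re_le z : `|complex.Re z| <= 1 + abs2 z.
Proof.
case: z => a b; rewrite /abs2/= -(real_normK (num_real a)).
have := sqr_ge0 b; have := sqr_ge0 (`|a| - 1); have := normr_ge0 a; nra.
Qed.

Lemma normr_Im_le z : `|complex.Im z| <= 1 + abs2 z.
Proof.
case: z => a b; rewrite /abs2/= -(real_normK (num_real b)).
have := sqr_ge0 a; have := sqr_ge0 (`|b| - 1); have := normr_ge0 b; nra.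
Qed.

(** If a <= b then 2(a + b) <= 4b. With [abs2D_le] this makes finiteness of all moments stable under
    sums. *)
Lemma exprD_le (a b : R) n : 0 <= a -> 0 <= b ->
  (2 * (a + b)) ^+ n <= 4 ^+ n * (a ^+ n + b ^+ n).
Proof.
move=> a0 b0; wlog ab : a b a0 b0 / a <= b.
  by move=> H; have [/H|/ltW/H] := leP a b; [|rewrite addrC [b ^+ n + _]addrC]; exact.
apply: (@le_trans _ _ (4 ^+ n * b ^+ n)).
  rewrite -exprMn; apply: lerXn2r; rewrite ?nnegrE; [| |lra].
    by rewrite mulr_ge0// addr_ge0.
  by rewrite mulr_ge0.
by apply: ler_wpM2l; rewrite ?exprn_ge0// lerDr exprn_ge0.
Qed.

End abs2.

Section complex_expectation.
Context d (T : measurableType d) (R : realType) (P : probability T R).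
Implicit Types (G H : set (set T)) (Z W : T -> R[i]) (f g : T -> R).

Local Notation integ f := (P.-integrable setT (EFin \o f)).
Local Notation "'E[' Z ]" := (cexpectation P Z) (format "'E[' Z ]").

Lemma le_integ f g : measurable_fun setT f -> (forall w, `|f w| <= g w) ->
  integ g -> integ f.
Proof.
move=> mf fg; apply: (le_integrable measurableT); first exact/measurable_EFinP.
by move=> w _ /=; rewrite lee_fin (le_trans (fg w))// ler_norm.
Qed.

Lemma fine_expectationD f g : integ f -> integ g ->
  fine ('E_P[fun w => f w + g w]) = fine ('E_P[f]) + fine ('E_P[g]).
Proof.
move=> fi gi; rewrite unlock.
under eq_integral do rewrite EFinD.
by rewrite integralD// fineD// integrable_fin_num.
Qed.

Lemma fine_expectationZ f (c : R) : integ f ->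
  fine ('E_P[fun w => c * f w]) = c * fine ('E_P[f]).
Proof.
move=> fi; rewrite unlock.
under eq_integral do rewrite EFinM.
by rewrite integralZl// fineM// integrable_fin_num.
Qed.

Definition cintegrable Z : Prop :=
  integ (fun w => complex.Re (Z w)) /\ integ (fun w => complex.Im (Z w)).

Lemma cintegrable_cst (c : R[i]) : cintegrable (fun=> c).
Proof. by split; exact: finite_measure_integrable_cst. Qed.

Lemma cintegrableD Z W : cintegrable Z -> cintegrable W ->
  cintegrable (fun w => Z w + W w).
Proof.
move=> [Zr Zi] [Wr Wi]; split.
- rewrite (_ : _ \o _ = (EFin \o (fun w => complex.Re (Z w))) \+ (EFin \o (fun w =>
  complex.Re (W w))))%E.
    exact: integrableD.
  by apply/funext => w /=; rewrite raddfD.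
- rewrite (_ : _ \o _ = (EFin \o (fun w => complex.Im (Z w))) \+ (EFin \o (fun w =>
  complex.Im (W w))))%E.
    exact: integrableD.
  by apply/funext => w /=; rewrite raddfD.
Qed.

Lemma cexpectationD Z W : cintegrable Z -> cintegrable W ->
  E[fun w => Z w + W w] = E[Z] + E[W].
Proof.
move=> [Zr Zi] [Wr Wi]; apply/eqP; rewrite eq_complex/=.
rewrite -!fine_expectationD//; apply/andP; split; apply/eqP;
  by congr (fine 'E_P[_]); apply/funext => w; rewrite raddfD.
Qed.

Lemma cintegrable_conjc Z : cintegrable Z -> cintegrable (fun w => (Z w)^@).
Proof.
move=> [Zr Zi]; split.
- by rewrite (_ : _ \o _ = (EFin \o (fun w => complex.Re (Z w))))//; apply/funext => w
  /=; case: (Z w).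
- have := integrableN Zi; congr (_.-integrable _ _).
  by apply/funext => w /=; case: (Z w).
Qed.

Lemma cexpectation_conjc Z : cintegrable Z -> E[fun w => (Z w)^@] = E[Z]^@.
Proof.
move=> [Zr Zi]; rewrite /cexpectation/=; congr (_ +i* _).
  by congr (fine 'E_P[_]); apply/funext => w; case: (Z w).
rewrite -mulN1r -fine_expectationZ//; congr (fine 'E_P[_]); apply/funext => w.
by rewrite mulN1r; case: (Z w).
Qed.

Lemma cintegrableZ Z (c : R[i]) : cintegrable Z -> cintegrable (fun w => c * Z w).
Proof.
move=> [Zr Zi]; split.
- have := integrableB measurableT (integrableZl measurableT (complex.Re c) Zr)
    (integrableZl measurableT (complex.Im c) Zi).
  by congr (_.-integrable _ _); apply/funext => w /=; case: (Z w); case: c.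
- have := integrableD measurableT (integrableZl measurableT (complex.Re c) Zi)
    (integrableZl measurableT (complex.Im c) Zr).
  congr (_.-integrable _ _); apply/funext => w /=; case: (Z w); case: c => a b a' b' /=.
  by rewrite -!EFinM -EFinD.
Qed.

Lemma integZ f (c : R) : integ f -> integ (fun w => c * f w).
Proof. by move=> fi; have := integrableZl measurableT c fi; congr (_.-integrable _ _).
  Qed.

Lemma cexpectationZ Z (c : R[i]) : cintegrable Z -> E[fun w => c * Z w] = c * E[Z].
Proof.
move=> [Zr Zi]; rewrite /cexpectation; case: c => a b.
apply/eqP; rewrite eq_complex/= -mulNr -!fine_expectationZ// -!fine_expectationD//; try
  exact: integZ.
apply/andP; split; apply/eqP; congr (fine 'E_P[_]); apply/funext => w; case: (Z w) => x
  y //=.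
by rewrite mulNr.
Qed.

Lemma cexpectation_cst (c : R[i]) : E[fun=> c] = c.
Proof. by rewrite /cexpectation !expectation_cst; case: c. Qed.

Lemma cintegrable_sum (I : Type) (r : seq I) (Q : pred I) (Z : I -> T -> R[i]) :
  (forall i, Q i -> cintegrable (Z i)) ->
  cintegrable (fun w => \sum_(i <- r | Q i) Z i w).
Proof.
move=> iZ; elim: r => [|i r IH].
  by rewrite (_ : (fun w => _) = fun=> 0); [exact: cintegrable_cst|apply/funext => w;
    rewrite big_nil].
have [Qi|Qi] := boolP (Q i).
  rewrite (_ : (fun w => _) = fun w => Z i w + \sum_(i <- r | Q i) Z i w).
    by apply: cintegrableD => //; exact: iZ.
  by apply/funext => w; rewrite big_cons Qi.
by rewrite (_ : (fun w => _) = fun w => \sum_(i <- r | Q i) Z i w)//; apply/funext =>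
  w; rewrite big_cons (negbTE Qi).
Qed.

Lemma cexpectation_sum (I : Type) (r : seq I) (Q : pred I) (Z : I -> T -> R[i]) :
  (forall i, Q i -> cintegrable (Z i)) ->
  E[fun w => \sum_(i <- r | Q i) Z i w] = \sum_(i <- r | Q i) E[Z i].
Proof.
move=> iZ; elim: r => [|i r IH].
  by rewrite big_nil -[RHS](cexpectation_cst 0); congr cexpectation; apply/funext => w;
    rewrite big_nil.
rewrite big_cons; case: ifPn => Qi.
  rewrite -IH -cexpectationD; [|exact: iZ|exact: cintegrable_sum].
  by congr cexpectation; apply/funext => w; rewrite big_cons Qi.
by rewrite -IH; congr cexpectation; apply/funext => w; rewrite big_cons (negbTE Qi).
Qed.

(** Unlike [cmeasurable], this records which variables Z is a function of, which is what
    independence arguments consume. *)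
Definition cmeas G Z : Prop :=
  measurable_fun (setT : set (g_sigma_algebraType G)) (fun w => complex.Re (Z w)) /\
  measurable_fun (setT : set (g_sigma_algebraType G)) (fun w => complex.Im (Z w)).

Lemma cmeasD G Z W : cmeas G Z -> cmeas G W -> cmeas G (fun w => Z w + W w).
Proof.
move=> [Zr Zi] [Wr Wi]; split.
- rewrite (_ : (fun w => _) = (fun w => complex.Re (Z w) + complex.Re (W w))).
    exact: measurable_funD.
  by apply/funext => w; rewrite raddfD.
- rewrite (_ : (fun w => _) = (fun w => complex.Im (Z w) + complex.Im (W w))).
    exact: measurable_funD.
  by apply/funext => w; rewrite raddfD.
Qed.

Lemma cmeasM G Z W : cmeas G Z -> cmeas G W -> cmeas G (fun w => Z w * W w).
Proof.
move=> [Zr Zi] [Wr Wi]; split.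
- rewrite (_ : (fun w => _) = (fun w => complex.Re (Z w) * complex.Re (W w) -
  complex.Im (Z w) * complex.Im (W w))).
    by apply: measurable_funB; exact: measurable_funM.
  by apply/funext => w; case: (Z w); case: (W w).
- rewrite (_ : (fun w => _) = (fun w => complex.Re (Z w) * complex.Im (W w) +
  complex.Im (Z w) * complex.Re (W w))).
    by apply: measurable_funD; exact: measurable_funM.
  by apply/funext => w; case: (Z w) => a b; case: (W w).
Qed.

Lemma cmeas_conjc G Z : cmeas G Z -> cmeas G (fun w => (Z w)^@).
Proof.
move=> [Zr Zi]; split.
- by rewrite (_ : (fun w => _) = (fun w => complex.Re (Z w)))//; apply/funext => w;
  case: (Z w).
- rewrite (_ : (fun w => _) = (fun w => - complex.Im (Z w)))//; last by apply/funext =>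
  w; case: (Z w).
  exact: measurable_funN.
Qed.

Lemma cmeas_sub G H Z : G `<=` <<s H>> -> cmeas G Z -> cmeas H Z.
Proof.
move=> GH [Zr Zi].
have sGH : <<s G>> `<=` <<s H>> by apply: smallest_sub => //; exact:
  smallest_sigma_algebra.
by split=> _ B mB; apply: sGH; [exact: Zr|exact: Zi].
Qed.

Lemma cmeas_cmeasurable G Z : G `<=` measurable -> cmeas G Z -> cmeasurable Z.
Proof.
move=> GH [Zr Zi].
have sGH : <<s G>> `<=` measurable by apply: smallest_sub => //; exact:
  sigma_algebra_measurable.
by split=> _ B mB; apply: sGH; [exact: Zr|exact: Zi].
Qed.

End complex_expectation.

(** * Products of independent variables *)

Section independent_products.
Context d (T : measurableType d) (R : realType) (P : probability T R).
Implicit Types (G H : set (set T)) (Z W X Y : T -> R[i]).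

Local Notation integ f := (P.-integrable setT (EFin \o f)).
Local Notation "'E[' Z ]" := (cexpectation P Z) (format "'E[' Z ]").

Definition indep_gen G H : Prop := forall A B,
  <<s G>> A -> <<s H>> B -> P (A `&` B) = (P A * P B)%E.

Lemma indep_genC G H : indep_gen G H -> indep_gen H G.
Proof. by move=> GH A B hA hB; rewrite setIC muleC GH. Qed.

Lemma indep_gen_sub G G' H H' : G `<=` <<s G'>> -> H `<=` <<s H'>> ->
  indep_gen G' H' -> indep_gen G H.
Proof.
move=> GG HH GH A B hA hB; apply: GH.
- by move: A hA; apply: smallest_sub => //; exact: smallest_sigma_algebra.
- by move: B hB; apply: smallest_sub => //; exact: smallest_sigma_algebra.
Qed.

Lemma indep_gen_integM G H (f g : T -> R) : indep_gen G H ->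
  measurable_fun (setT : set (g_sigma_algebraType G)) f ->
  measurable_fun (setT : set (g_sigma_algebraType H)) g ->
  integ f -> integ g ->
  integ (fun w => f w * g w) /\
  fine 'E_P[fun w => f w * g w] = fine 'E_P[f] * fine 'E_P[g].
Proof.
move=> GH mf mg fi gi.
have [|] := @indep_integralM _ _ _ P _ _ fi gi.
  move=> A B mA mB; apply: GH.
  - by have := mf measurableT _ mA; rewrite setTI.
  - by have := mg measurableT _ mB; rewrite setTI.
move=> h1 h2; split => //; rewrite unlock h2 fineM// integrable_fin_num//.
Qed.

(** Expand the product into its four real products. Independence yields their integrability from
    that of the factors, without any second moment. *)
Lemma indep_gen_cexpectationM G H X Y : indep_gen G H ->
  cmeas G X -> cmeas H Y -> cintegrable P X -> cintegrable P Y ->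
  cintegrable P (fun w => X w * Y w) /\ E[fun w => X w * Y w] = E[X] * E[Y].
Proof.
move=> GH [mXr mXi] [mYr mYi] [Xr Xi] [Yr Yi].
have [irr Err] := indep_gen_integM GH mXr mYr Xr Yr.
have [iri Eri] := indep_gen_integM GH mXr mYi Xr Yi.
have [iir Eir] := indep_gen_integM GH mXi mYr Xi Yr.
have [iii Eii] := indep_gen_integM GH mXi mYi Xi Yi.
have iN := integZ (-1) iii.
have RE : (fun w => complex.Re (X w * Y w)) = (fun w => complex.Re (X w) * complex.Re
  (Y w) +
    (-1) * (complex.Im (X w) * complex.Im (Y w))).
  by apply/funext => w; rewrite mulN1r; case: (X w); case: (Y w).
have IE : (fun w => complex.Im (X w * Y w)) = (fun w => complex.Re (X w) * complex.Im
  (Y w) +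
    complex.Im (X w) * complex.Re (Y w)).
  by apply/funext => w; case: (X w); case: (Y w).
split.
  split; rewrite ?RE ?IE.
  - by have := integrableD measurableT irr iN; congr (_.-integrable _ _).
  - by have := integrableD measurableT iri iir; congr (_.-integrable _ _).
apply/eqP; rewrite eq_complex/= RE IE !fine_expectationD// fine_expectationZ//.
by rewrite Err Eri Eir Eii mulN1r !eqxx.
Qed.

(** These variables form an algebra closed under conjugation, so every polynomial in Gaussian
    entries is integrable without further estimates. *)
Definition cmoments G Z : Prop :=
  [/\ G `<=` measurable, cmeas G Z & forall n, integ (fun w => abs2 (Z w) ^+ n)].

Lemma measurable_abs2 Z n : cmeasurable Z ->
  measurable_fun setT (fun w => abs2 (Z w) ^+ n).
Proof.
move=> [Zr Zi]; apply: measurable_funX; apply: measurable_funD; exact: measurable_funX.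
Qed.

Lemma cmoments_sub G H Z : H `<=` measurable -> G `<=` <<s H>> ->
  cmoments G Z -> cmoments H Z.
Proof. by move=> mH GH [mG mZ iZ]; split => //; exact: cmeas_sub mZ. Qed.

Lemma cmoments_integrable G Z : cmoments G Z -> cintegrable P Z.
Proof.
move=> [mG mZ iZ]; have [Zr Zi] := cmeas_cmeasurable mG mZ.
have i1 : integ (fun w => 1 + abs2 (Z w)).
  have := integrableD measurableT (iZ 0) (iZ 1).
  by congr (_.-integrable _ _); apply/funext => w /=; rewrite expr0 expr1.
split; apply: (le_integ _ _ i1) => //.
- by move=> w; exact: normr_Re_le.
- by move=> w; exact: normr_Im_le.
Qed.

Lemma cmoments_cst G c : G `<=` measurable -> cmoments G (fun=> c).
Proof. by move=> mG; split => // n; exact: finite_measure_integrable_cst. Qed.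

Lemma cmoments_conjc G Z : cmoments G Z -> cmoments G (fun w => (Z w)^@).
Proof.
move=> [mG mZ iZ]; split => //; first exact: cmeas_conjc.
by move=> n; have := iZ n; congr (_.-integrable _ _); apply/funext => w /=; rewrite
  abs2_conjc.
Qed.

Lemma cmomentsM G Z W : cmoments G Z -> cmoments G W ->
  cmoments G (fun w => Z w * W w).
Proof.
move=> [mG mZ iZ] [_ mW iW]; have mZW := cmeasM mZ mW; split => // n.
have [mr mi] := cmeas_cmeasurable mG mZW.
have i2 := integrableD measurableT (iZ n.*2) (iW n.*2).
apply: (le_integ (g := fun w => abs2 (Z w) ^+ n.*2 + abs2 (W w) ^+ n.*2)) => //.
- exact: measurable_abs2 (conj mr mi).
- move=> w; rewrite abs2M exprMn -muln2 !exprM.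
  have a0 := exprn_ge0 n (abs2_ge0 (Z w)); have b0 := exprn_ge0 n (abs2_ge0 (W w)).
  rewrite ger0_norm ?mulr_ge0//.
  have := sqr_ge0 (abs2 (Z w) ^+ n - abs2 (W w) ^+ n); nra.
Qed.

Lemma cmomentsD G Z W : cmoments G Z -> cmoments G W ->
  cmoments G (fun w => Z w + W w).
Proof.
move=> [mG mZ iZ] [_ mW iW]; have mZW := cmeasD mZ mW; split => // n.
have [mr mi] := cmeas_cmeasurable mG mZW.
have i2 := integZ (4 ^+ n) (integrableD measurableT (iZ n) (iW n)).
apply: (le_integ _ _ i2).
- exact: measurable_abs2 (conj mr mi).
- move=> w; rewrite ger0_norm ?exprn_ge0 ?abs2_ge0//.
  apply: le_trans (exprD_le n (abs2_ge0 (Z w)) (abs2_ge0 (W w))).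
  apply: lerXn2r (abs2D_le _ _); rewrite nnegrE ?abs2_ge0//.
  by rewrite mulr_ge0// addr_ge0 ?abs2_ge0.
Qed.

Lemma cmoments_sum G (I : Type) (r : seq I) (Q : pred I) (Z : I -> T -> R[i]) :
  G `<=` measurable -> (forall i, Q i -> cmoments G (Z i)) ->
  cmoments G (fun w => \sum_(i <- r | Q i) Z i w).
Proof.
move=> mG iZ; elim: r => [|i r IH].
  by rewrite (_ : (fun w => _) = fun=> 0); [exact: cmoments_cst|apply/funext => w;
    rewrite big_nil].
have [Qi|Qi] := boolP (Q i).
  rewrite (_ : (fun w => _) = fun w => Z i w + \sum_(i <- r | Q i) Z i w).
    by apply: cmomentsD => //; exact: iZ.
  by apply/funext => w; rewrite big_cons Qi.
by rewrite (_ : (fun w => _) = fun w => \sum_(i <- r | Q i) Z i w)//; apply/funext =>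
  w; rewrite big_cons (negbTE Qi).
Qed.

Lemma sum_mul_conjc (I : finType) (al be al' be' : I -> R[i]) :
  (\sum_a al a * be a) * (\sum_a al' a * be' a)^@ =
  \sum_a \sum_b (al a * (al' b)^@) * (be a * (be' b)^@).
Proof.
rewrite mulr_suml; apply: eq_bigr => a _; rewrite rmorph_sum mulr_sumr.
by apply: eq_bigr => b _; rewrite rmorphM/=; ring.
Qed.

(* Second moments of a bilinear form in two independent families, one of
   which is uncorrelated: conditioning on the other family diagonalizes it. *)
Lemma cexpectation_bilinear G H (I : finType) (al al' be be' : I -> T -> R[i])
    (s : I -> R[i]) :
  indep_gen G H ->
  (forall a b, cmeas G (fun w => al a w * (al' b w)^@)) ->
  (forall a b, cintegrable P (fun w => al a w * (al' b w)^@)) ->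
  (forall a b, cmeas H (fun w => be a w * (be' b w)^@)) ->
  (forall a b, cintegrable P (fun w => be a w * (be' b w)^@)) ->
  (forall a b, E[fun w => al a w * (al' b w)^@] = if a == b then s a else 0) ->
  cintegrable P (fun w => (\sum_a al a w * be a w) * (\sum_a al' a w * be' a w)^@) /\
  E[fun w => (\sum_a al a w * be a w) * (\sum_a al' a w * be' a w)^@] =
  \sum_a s a * E[fun w => be a w * (be' a w)^@].
Proof.
move=> GH mal ial mbe ibe Eal.
have H2 a b := indep_gen_cexpectationM GH (mal a b) (mbe a b) (ial a b) (ibe a b).
rewrite (_ : (fun w => _) = (fun w => \sum_a \sum_b
   (al a w * (al' b w)^@) * (be a w * (be' b w)^@))); last first.
  by apply/funext => w; exact: sum_mul_conjc.
have H1 a : cintegrable P (fun w => \sum_b (al a w * (al' b w)^@) * (be a w * (be' b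
  w)^@)).
  by apply: cintegrable_sum => b _; have [] := H2 a b.
split; first by apply: cintegrable_sum => a _.
rewrite cexpectation_sum//; apply: eq_bigr => a _.
rewrite cexpectation_sum; last by move=> b _; have [] := H2 a b.
rewrite (bigD1 a)//= big1 ?addr0; first by rewrite (H2 a a).2 Eal eqxx.
by move=> b ba; rewrite (H2 a b).2 Eal eq_sym (negbTE ba) mul0r.
Qed.

End independent_products.

(** * Grouping of independent families *)

Section grouping.
Context d (T : measurableType d) (R : realType) (P : probability T R).
Implicit Types (G H : set (set T)).

(** Both A |-> P (A [&] B) and A |-> P A * P B are finite measures; agreeing on a class closed under
    intersection that contains the whole space, they agree on the generated sigma-algebra. *)
Lemma setI_closed_indep_event G (B : set T) : G `<=` measurable ->
  setI_closed G -> G setT -> measurable B ->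
  (forall A, G A -> P (A `&` B) = P A * P B)%E ->
  forall A, <<s G>> A -> (P (A `&` B) = P A * P B)%E.
Proof.
move=> mG IG GT mB GB A sA.
have PBge0 : 0 <= fine (P B) by rewrite fine_ge0.
pose m1 : {measure set T -> \bar R} := mrestr P mB.
pose m2 : {measure set T -> \bar R} := mscale (NngNum PBge0) P.
have m2E C : m2 C = (P C * P B)%E.
  by rewrite /m2/= /mscale/= fineK ?fin_num_measure// muleC.
rewrite -m2E; apply: (@g_sigma_algebra_measure_unique _ _ _ G mG (fun=> setT) _ _ m1
  m2) => //.
- by rewrite bigcup_const//; exists 0%N.
- by move=> C GC; rewrite m2E -GB.
- by move=> _; rewrite /m1/= /mrestr setTI; rewrite -ge0_fin_numE ?fin_num_measure.
Qed.

Lemma setI_closed_indep_gen G H :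
  G `<=` measurable -> setI_closed G -> G setT ->
  H `<=` measurable -> setI_closed H -> H setT ->
  (forall A B, G A -> H B -> P (A `&` B) = P A * P B)%E -> indep_gen P G H.
Proof.
move=> mG IG GT mH IH HT GH A B sA sB.
have mB : measurable B.
  by move: B sB; apply: smallest_sub => //; exact: sigma_algebra_measurable.
apply: (setI_closed_indep_event (G := G)) => // {A sA} A GA.
rewrite setIC muleC; apply: (setI_closed_indep_event (G := H)) => //.
- exact: mG.
- by move=> {B sB mB} B HB; rewrite setIC muleC GH.
Qed.

Section family.
Variables (I : finType) (F : I -> set (set T)).
Hypotheses (mF : forall i, F i `<=` measurable) (IF : forall i, setI_closed (F i)).
Hypotheses (FT : forall i, F i setT) (indF : mutual_indep P F).

(** The union of the classes [F i] over S is not closed under intersection; these finite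
    intersections are, and they contain that union. *)
Definition cylinders (S : pred I) : set (set T) := [set A | exists E : I -> set T,
  [/\ forall i, F i (E i), forall i, ~~ S i -> E i = setT &
      A = \big[setI/setT]_(i : I) E i]].

Let cylT S : cylinders S setT.
Proof. by exists (fun=> setT); split => //; rewrite big1. Qed.

Let cylI S : setI_closed (cylinders S).
Proof.
move=> _ _ [E [FE ES ->]] [E' [FE' ES' ->]].
exists (fun i => E i `&` E' i); split; first by move=> i; exact: IF.
- by move=> i Si; rewrite ES// ES'// setTI.
- by rewrite big_split.
Qed.

Let cylm S : cylinders S `<=` measurable.
Proof.
move=> _ [E [FE _ ->]]; apply: bigsetI_measurable => i _; exact: mF.
Qed.

Let sub_cyl (S : pred I) : \bigcup_(i in [set i | S i]) F i `<=` cylinders S.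
Proof.
move=> A [i /= Si FA]; exists (fun j => if j == i then A else setT); split.
- by move=> j; case: eqP => // ->.
- by move=> j Sj; case: eqP => // ji; rewrite ji Si in Sj.
- by rewrite (bigD1 i)//= eqxx big1 ?setIT// => j /negbTE ->.
Qed.

Lemma mutual_indep_grouping (S S' : pred I) : (forall i, S i -> ~~ S' i) ->
  indep_gen P (\bigcup_(i in [set i | S i]) F i) (\bigcup_(i in [set i | S' i]) F i).
Proof.
move=> SS'; apply: (@indep_gen_sub _ _ _ _ _ (cylinders S) _ (cylinders S')).
- by apply: subset_trans (@sub_cyl S) _; exact: sub_sigma_algebra.
- by apply: subset_trans (@sub_cyl S') _; exact: sub_sigma_algebra.
apply: setI_closed_indep_gen => // _ _ [E [FE ES ->]] [E' [FE' ES' ->]].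
have PE E0 : (forall i, F i (E0 i)) ->
    (P (\big[setI/setT]_(i : I) E0 i) = \prod_(i : I) P (E0 i))%E.
  by move=> FE0; rewrite indF// index_enum_uniq.
rewrite -big_split/= (PE _ FE) (PE _ FE') PE; last by move=> i; exact: IF.
rewrite -big_split/=; apply: eq_bigr => i _ /=.
(* S and S' are disjoint, so at each index at least one of the two events is the whole space. *)
have [Si|Si] := boolP (S i).
  by rewrite (ES' i) ?SS'// setIT probability_setT mule1.
by rewrite (ES i)// setTI probability_setT mul1e.
Qed.
End family.

Section generated.
Implicit Types (J : Type).

Lemma sigma_of_measurable J (Z : J -> T -> R[i]) :
  (forall j, cmeasurable (Z j)) -> sigma_of Z `<=` measurable.
Proof.
move=> mZ; apply: smallest_sub; first exact: sigma_algebra_measurable.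
move=> _ [j [B [mB [->|->]]]]; have [mr mi] := mZ j.
- by rewrite -[X in measurable X]setTI; exact: mr.
- by rewrite -[X in measurable X]setTI; exact: mi.
Qed.

Lemma sigma_of_setI J (Z : J -> T -> R[i]) : setI_closed (sigma_of Z).
Proof.
rewrite /sigma_of; set G := (X in <<s X>>).
by move=> A B; exact: (@measurableI _ (g_sigma_algebraType G)).
Qed.

Lemma sigma_of_setT J (Z : J -> T -> R[i]) : sigma_of Z setT.
Proof.
rewrite /sigma_of; set G := (X in <<s X>>).
exact: (@measurableT _ (g_sigma_algebraType G)).
Qed.

Lemma cmeas_sigma_of J (Z : J -> T -> R[i]) G j : sigma_of Z `<=` <<s G>> ->
  cmeas G (Z j).
Proof.
move=> ZG; split=> _ B mB; rewrite setTI; apply: ZG; apply: sub_sigma_algebra;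
  exists j, B; split => //; by [left|right].
Qed.

End generated.

End grouping.

(** * Moments of Gaussian matrices *)

Section gaussian_entries.
Context d (T : measurableType d) (R : realType) (P : probability T R).

Local Notation integ f := (P.-integrable setT (EFin \o f)).
Local Notation "'E[' Z ]" := (cexpectation P Z) (format "'E[' Z ]").

Lemma cexpectation_real (f : T -> R) : E[fun w => (f w)%:C] = (fine 'E_P[f])%:C.
Proof.
by rewrite /cexpectation/= expectation_cst.
Qed.

Lemma cgaussian_cmeasurable (Z : T -> R[i]) v : cgaussian P Z v -> cmeasurable Z.
Proof. by move=> [[mr _] [mi _] _]. Qed.

Section one_entry.
Variables (Z : T -> R[i]) (v : R).
Hypotheses (v0 : 0 <= v) (gZ : cgaussian P Z v).
Let v20 : 0 <= v / 2. Proof. by rewrite divr_ge0. Qed.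
Let x w := complex.Re (Z w).
Let y w := complex.Im (Z w).
Let gx : gaussian P x (v / 2). Proof. by have [] := gZ. Qed.
Let gy : gaussian P y (v / 2). Proof. by have [] := gZ. Qed.
Let ix k : integ (fun w => x w ^+ k).
Proof. by have [] := gaussian_pow_integral k v20 gx. Qed.
Let iy k : integ (fun w => y w ^+ k).
Proof. by have [] := gaussian_pow_integral k v20 gy. Qed.

(** The family [Z'] is any one containing [Z], so that the lemma serves both the sigma-algebra of a
    single entry and that of a whole matrix. *)
Lemma cgaussian_cmoments (J : Type) (j : J) (Z' : J -> T -> R[i]) :
  (forall j, cmeasurable (Z' j)) -> Z' j = Z -> cmoments P (sigma_of Z') Z.
Proof.
move=> mZ' ZE; split.
- exact: sigma_of_measurable.
- by rewrite -ZE; apply: cmeas_sigma_of; exact: sub_sigma_algebra.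
move=> n; have i2 := integZ (4 ^+ n) (integrableD measurableT (ix (2 * n)) (iy (2 * n))).
apply: (le_integ _ _ i2).
  exact: measurable_abs2 (cgaussian_cmeasurable gZ).
move=> w; rewrite ger0_norm ?exprn_ge0 ?abs2_ge0//= !exprM.
apply: le_trans (exprD_le n (sqr_ge0 (x w)) (sqr_ge0 (y w))).
apply: lerXn2r; rewrite ?nnegrE ?abs2_ge0// ?mulr_ge0// ?addr_ge0 ?sqr_ge0//.
by rewrite /abs2 -/(x w) -/(y w); have := sqr_ge0 (x w); have := sqr_ge0 (y w); lra.
Qed.

Lemma cgaussian_mean : E[Z] = 0.
Proof.
rewrite /cexpectation unlock (gaussian_moment1 v20 gx) (gaussian_moment1 v20 gy).
by [].
Qed.

Lemma cgaussian_abs2 : E[fun w => Z w * (Z w)^@] = v%:C.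
Proof.
rewrite (_ : (fun w => _) = (fun w => (x w ^+ 2 + y w ^+ 2)%:C)); last first.
  by apply/funext => w; rewrite -abs2E.
rewrite cexpectation_real fine_expectationD// unlock.
rewrite (gaussian_moment2 v20 gx) (gaussian_moment2 v20 gy)/=.
by rewrite -splitr.
Qed.

(** With independent parts of variance v/2, the mean of (x^2 + y^2)^2 is 2 * 3 (v/2)^2 + 2
    (v/2)^2. *)
Lemma cgaussian_abs4 :
  E[fun w => (Z w * (Z w)^@) * (Z w * (Z w)^@)] = (2 * v ^+ 2)%:C.
Proof.
have [_ _ xy] := gZ.
have msq : measurable_fun setT (fun t : R => t ^+ 2) by exact: exprn_measurable.
have [|ixy Exy] := indep_integralM (ix 2) (iy 2).
  move=> A B mA mB.
  have mA' := msq measurableT _ mA; have mB' := msq measurableT _ mB.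
  rewrite setTI in mA'; rewrite setTI in mB'.
  exact: (xy _ _ mA' mB').
rewrite (_ : (fun w => _) = (fun w => ((x w ^+ 4 + y w ^+ 4) + 2 * (x w ^+ 2 * y w ^+
  2))%:C)); last first.
  apply/funext => w; rewrite -abs2E -rmorphM/=; congr (_%:C).
  by rewrite /abs2 -/(x w) -/(y w); ring.
have i4 : integ (fun w => x w ^+ 4 + y w ^+ 4).
  by have := integrableD measurableT (ix 4) (iy 4); congr (_.-integrable _ _).
rewrite cexpectation_real fine_expectationD//; last exact: integZ.
rewrite fine_expectationD// fine_expectationZ// unlock.
rewrite (gaussian_moment4 v20 gx) (gaussian_moment4 v20 gy).
rewrite Exy (gaussian_moment2 v20 gx) (gaussian_moment2 v20 gy)/=.
by congr (_%:C); field.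
Qed.
End one_entry.

Section matrix.
Variables (m n : nat) (X : T -> 'M[R[i]]_(m, n)) (v : 'I_n -> R).
Hypotheses (v0 : forall i, 0 <= v i) (gX : cgaussian_mx P X v).

Local Notation entry := (fun e : 'I_m * 'I_n =>
  sigma_of (fun (_ : unit) w => X w e.1 e.2)).

Lemma cgaussian_mx_cmeasurable : cmeasurable_mx X.
Proof. by move=> a i; exact: cgaussian_cmeasurable (gX.1 a i). Qed.

Lemma cmoments_entry a i : cmoments P (sigma_mx X) (fun w => X w a i).
Proof.
apply: (cgaussian_cmoments (v0 i) (gX.1 a i) (j := (a, i))) => // -[b j].
exact: cgaussian_mx_cmeasurable.
Qed.

(** Isolating one entry from all the others lets the mean of a monomial factor through that
    entry. *)
Let others (e : 'I_m * 'I_n) := \bigcup_(e' in [set e' | e' != e]) entry e'.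
Let only (e : 'I_m * 'I_n) := \bigcup_(e' in [set e' | e' == e]) entry e'.

Let entry_m e : entry e `<=` measurable.
Proof. by apply: sigma_of_measurable => _; exact: cgaussian_mx_cmeasurable. Qed.

Let indep_entry e : indep_gen P (only e) (others e).
Proof.
apply: (@mutual_indep_grouping _ _ _ P _ entry _ _ _ gX.2 (fun e' => e' == e)
  (fun e' => e' != e)).
- exact: entry_m.
- by move=> e'; exact: sigma_of_setI.
- by move=> e'; exact: sigma_of_setT.
- by move=> e' ->.
Qed.

Let cmoments_cup (Q : pred ('I_m * 'I_n)) (e : 'I_m * 'I_n) : Q e ->
  cmoments P (\bigcup_(e' in [set e' | Q e']) entry e') (fun w => X w e.1 e.2).
Proof.
move=> Qe; have : cmoments P (entry e) (fun w => X w e.1 e.2).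
  apply: (cgaussian_cmoments (v0 e.2) (gX.1 e.1 e.2) (j := tt)) => // _.
  exact: cgaussian_mx_cmeasurable.
apply: cmoments_sub; first by apply: bigcup_sub => e' _; exact: entry_m.
by move=> A hA; apply: sub_sigma_algebra; exists e.
Qed.

Let cmoments_only a i : cmoments P (only (a, i)) (fun w => X w a i).
Proof. exact: (@cmoments_cup (fun e' => e' == (a, i)) (a, i)). Qed.

Let cmoments_others a i b j : (b, j) != (a, i) -> cmoments P (others (a, i)) (fun w =>
  X w b j).
Proof. exact: (@cmoments_cup (fun e' => e' != (a, i)) (b, j)). Qed.

Let indep_entryM a i Y Z : cmoments P (only (a, i)) Y -> cmoments P (others (a, i)) Z ->
  E[fun w => Y w * Z w] = E[Y] * E[Z].
Proof.
move=> mY mZ; have [_ cY _] := mY; have [_ cZ _] := mZ.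
have iY := cmoments_integrable mY; have iZ := cmoments_integrable mZ.
by have [] := indep_gen_cexpectationM (@indep_entry (a, i)) cY cZ iY iZ.
Qed.

Lemma cexpectation_entry a i : E[fun w => X w a i] = 0.
Proof. exact: cgaussian_mean (v0 i) (gX.1 a i). Qed.

Lemma cexpectation_entry_conjc a i : E[fun w => (X w a i)^@] = 0.
Proof.
rewrite cexpectation_conjc ?cexpectation_entry ?rmorph0//.
exact: cmoments_integrable (cmoments_entry a i).
Qed.

Lemma cexpectation_entry2 a i b j : E[fun w => X w a i * (X w b j)^@] =
  if (a == b) && (i == j) then (v i)%:C else 0.
Proof.
case: ifPn => [/andP[/eqP <- /eqP <-]|abij]; first exact: cgaussian_abs2 (v0 i) (gX.1 a
  i).
rewrite (@indep_entryM a i); first by rewrite cexpectation_entry mul0r.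
- exact: cmoments_only.
- by apply: cmoments_conjc; apply: cmoments_others; rewrite xpair_eqE eq_sym [j ==
  i]eq_sym.
Qed.

(* An entry occurring only once in a monomial is independent of the rest,
   so the monomial has mean zero. *)
Let cexpectation_solo a i Z : cmoments P (others (a, i)) Z ->
  E[fun w => (X w a i)^@ * Z w] = 0 /\ E[fun w => X w a i * Z w] = 0.
Proof.
move=> mZ; split; rewrite (@indep_entryM a i)//; try exact: cmoments_only.
- by rewrite cexpectation_entry_conjc mul0r.
- exact/cmoments_conjc/cmoments_only.
- by rewrite cexpectation_entry mul0r.
Qed.

(** Only pairings of an entry with its own conjugate contribute. Pairing across the two factors
    needs a = b and j = l and gives v_i v_j; pairing inside each factor needs i = j = l and gives
    v_i^2. *)
Lemma cexpectation_entry4 a b i j l :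
  E[fun w => ((X w a j)^@ * X w a i) * ((X w b l)^@ * X w b i)^@] =
  if j == l then (((a == b)%:R * (v i * v j)) + (i == j)%:R * v i ^+ 2)%:C else 0.
Proof.
have [<-{l}|jl] := eqVneq j l; last first.
  (* As j and l differ, some entry occurs only once: (b, l) when j = i, and (a, j) otherwise. *)
  have [ji|ji] := eqVneq j i.
    rewrite -ji (_ : (fun w => _) = (fun w => X w b l * ((X w a j)^@ * X w a j * (X w b
      j)^@))); last first.
      by apply/funext => w; rewrite conjcM conjc_invol; ring.
    apply: (cexpectation_solo _).2; apply: cmomentsM; last
      apply/cmoments_conjc/cmoments_others.
      by apply: cmomentsM; [apply/cmoments_conjc|]; apply: cmoments_others; rewrite
        xpair_eqE (negbTE jl) andbF.
    by rewrite xpair_eqE (negbTE jl) andbF.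
  rewrite (_ : (fun w => _) = (fun w => (X w a j)^@ * (X w a i * (X w b l * (X w b
    i)^@)))); last first.
    by apply/funext => w; rewrite conjcM conjc_invol; ring.
  apply: (cexpectation_solo _).1; apply: cmomentsM; first apply: cmoments_others.
    by rewrite xpair_eqE [i == j]eq_sym (negbTE ji) andbF.
  apply: cmomentsM; last apply: cmoments_conjc; apply: cmoments_others.
    by rewrite xpair_eqE [l == j]eq_sym (negbTE jl) andbF.
  by rewrite xpair_eqE [i == j]eq_sym (negbTE ji) andbF.
have [<-{j}|ij] := eqVneq i j.
  have [<-|ab] := eqVneq a b.
    rewrite (_ : (fun w => _) = (fun w => (X w a i * (X w a i)^@) * (X w a i * (X w a
      i)^@))); last first.
      by apply/funext => w; rewrite conjcM conjc_invol; ring.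
    rewrite (cgaussian_abs4 (v0 i) (gX.1 a i)).
    by congr (_%:C); rewrite !mul1r; ring.
  rewrite (_ : (fun w => _) = (fun w => (X w a i * (X w a i)^@) * (X w b i * (X w b
    i)^@))); last first.
    by apply/funext => w; rewrite conjcM conjc_invol; ring.
  have ba : (b, i) != (a, i) by rewrite xpair_eqE eq_sym (negbTE ab).
  rewrite (@indep_entryM a i); last 2 first.
  - by apply: cmomentsM; [|apply: cmoments_conjc]; exact: cmoments_only.
  - by apply: cmomentsM; [|apply: cmoments_conjc]; exact: cmoments_others.
  by rewrite !cexpectation_entry2 !eqxx/= -rmorphM mul0r add0r mul1r.
have ija : (a, i) != (a, j) by rewrite xpair_eqE (negbTE ij) andbF.
have ijb : (b, i) != (a, j) by rewrite xpair_eqE (negbTE ij) andbF.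
rewrite (mul0r (v i ^+ 2)) addr0; have [<-|ab] := eqVneq a b.
  rewrite (_ : (fun w => _) = (fun w => (X w a j * (X w a j)^@) * (X w a i * (X w a
    i)^@))); last first.
    by apply/funext => w; rewrite conjcM conjc_invol; ring.
  rewrite (@indep_entryM a j); last 2 first.
  - by apply: cmomentsM; [|apply: cmoments_conjc]; exact: cmoments_only.
  - by apply: cmomentsM; [|apply: cmoments_conjc]; exact: cmoments_others.
  by rewrite !cexpectation_entry2 !eqxx/= -rmorphM mul1r mulrC.
(* With a and b distinct and i and j distinct, the entry (a, j) occurs only once. *)
have bja : (b, j) != (a, j) by rewrite xpair_eqE eq_sym (negbTE ab).
rewrite (_ : (fun w => _) = (fun w => (X w a j)^@ * (X w a i * (X w b j * (X w b
  i)^@)))); last first.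
  by apply/funext => w; rewrite conjcM conjc_invol; ring.
rewrite mul0r; apply: (cexpectation_solo _).1.
by apply: cmomentsM; [|apply: cmomentsM; [|apply: cmoments_conjc]]; exact:
  cmoments_others.
Qed.

End matrix.
End gaussian_entries.

Lemma sum_ord_const (R : pzRingType) m (x : R) : \sum_(k < m) x = m%:R * x.
Proof. by rewrite sumr_const card_ord mulr_natl. Qed.

(** * First and second moments of matched filters *)

Section matched_filter.
Context d (T : measurableType d) (R : realType) (P : probability T R).
Variables (m n : nat) (X Z : T -> 'M[R[i]]_(m, n)) (vX vZ : 'I_n -> R).
Hypotheses (vX0 : forall i, 0 <= vX i) (vZ0 : forall i, 0 <= vZ i).
Hypotheses (gX : cgaussian_mx P X vX) (gZ : cgaussian_mx P Z vZ).
Hypothesis XZ : indep_gen P (sigma_mx X) (sigma_mx Z).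

Local Notation "'E[' Z ]" := (cexpectation P Z) (format "'E[' Z ]").

(* For Y = X + Z with columns y_i, [filter_out i a] is entry a of X^H y_i,
   [filter_est i a] that of X^H x_i and [filter_err i a] that of X^H z_i. *)
Definition filter_est i a w : R[i] := \sum_(k < m) (X w k a)^@ * X w k i.
Definition filter_err i a w : R[i] := \sum_(k < m) Z w k i * (X w k a)^@.
Definition filter_out i a w : R[i] := \sum_(k < m) (X w k a)^@ * (X w k i + Z w k i).

Lemma filter_outE i a w : filter_out i a w = filter_est i a w + filter_err i a w.
Proof.
by rewrite -big_split/=; apply: eq_bigr => k _; rewrite mulrDr [Z w k i * _]mulrC.
Qed.

Let mX : sigma_mx X `<=` measurable.
Proof. by apply: sigma_of_measurable => -[k i]; exact: cgaussian_mx_cmeasurable gX _ _.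
  Qed.
Let mZ : sigma_mx Z `<=` measurable.
Proof. by apply: sigma_of_measurable => -[k i]; exact: cgaussian_mx_cmeasurable gZ _ _.
  Qed.

Let eX k i : cmoments P (sigma_mx X) (fun w => X w k i).
Proof. exact: (cmoments_entry vX0 gX). Qed.
Let eZ k i : cmoments P (sigma_mx Z) (fun w => Z w k i).
Proof. exact: (cmoments_entry vZ0 gZ). Qed.

Let mU : sigma_mx X `|` sigma_mx Z `<=` measurable.
Proof. by move=> A [/mX|/mZ]. Qed.

Let XU W : cmoments P (sigma_mx X) W -> cmoments P (sigma_mx X `|` sigma_mx Z) W.
Proof.
by apply: cmoments_sub => // A hA; apply: sub_sigma_algebra; left.
Qed.

Let ZU W : cmoments P (sigma_mx Z) W -> cmoments P (sigma_mx X `|` sigma_mx Z) W.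
Proof.
by apply: cmoments_sub => // A hA; apply: sub_sigma_algebra; right.
Qed.

Lemma filter_est_cmoments i a : cmoments P (sigma_mx X) (filter_est i a).
Proof.
by apply: cmoments_sum => // k _; apply: cmomentsM => //; exact: cmoments_conjc.
Qed.

Lemma filter_out_cmoments i a : cmoments P (sigma_mx X `|` sigma_mx Z) (filter_out i a).
Proof.
apply: cmoments_sum => // k _; apply: cmomentsM; first exact/XU/cmoments_conjc.
by apply: cmomentsD; [exact: XU|exact: ZU].
Qed.

Let filter_err_cmoments i a : cmoments P (sigma_mx X `|` sigma_mx Z) (filter_err i a).
Proof.
by apply: cmoments_sum => // k _; apply: cmomentsM; [exact: ZU|exact/XU/cmoments_conjc].
Qed.

Let indepM W Y : cmoments P (sigma_mx X) W -> cmoments P (sigma_mx Z) Y ->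
  cintegrable P (fun w => Y w * W w) /\ E[fun w => Y w * W w] = E[Y] * E[W].
Proof.
move=> mW mY; have [_ cY _] := mY; have [_ cW _] := mW.
exact: (indep_gen_cexpectationM (indep_genC XZ) cY cW (cmoments_integrable mY)
  (cmoments_integrable mW)).
Qed.

Lemma cexpectation_conj_entry2 k l i a :
  E[fun w => (X w k a)^@ * X w l i] = if (k == l) && (i == a) then (vX i)%:C else 0.
Proof.
rewrite (_ : (fun w => _) = (fun w => X w l i * (X w k a)^@)); last first.
  by apply/funext => w; rewrite mulrC.
by rewrite (cexpectation_entry2 vX0 gX) [l == k]eq_sym.
Qed.

Lemma cexpectation_filter_est i a :
  E[filter_est i a] = if i == a then (m%:R * vX i)%:C else 0.
Proof.
rewrite cexpectation_sum; last first.
  move=> k _; apply: (@cmoments_integrable _ _ _ _ (sigma_mx X)).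
  by apply: cmomentsM => //; exact: cmoments_conjc.
under eq_bigr do rewrite cexpectation_conj_entry2 eqxx/=.
by rewrite sum_ord_const natrC; case: ifP; rewrite ?mulr0 ?realCM.
Qed.

Lemma cexpectation_filter_out i a :
  E[filter_out i a] = if i == a then (m%:R * vX i)%:C else 0.
Proof.
rewrite (_ : filter_out i a = (fun w => filter_est i a w + filter_err i a w)); last first.
  by apply/funext => w; rewrite filter_outE.
rewrite cexpectationD; last 2 first.
- exact: cmoments_integrable (filter_est_cmoments i a).
- exact: cmoments_integrable (filter_err_cmoments i a).
rewrite cexpectation_filter_est -[RHS]addr0; congr (_ + _).
rewrite cexpectation_sum; last first.
  by move=> k _; exact: (indepM (cmoments_conjc (eX k a)) (eZ k i)).1.
rewrite big1// => k _.
rewrite (indepM (cmoments_conjc (eX k a)) (eZ k i)).2.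
by rewrite (cexpectation_entry vZ0 gZ) mul0r.
Qed.

(* E|(X^H y_i)_a|^2 when the entries of y_i have variance s. *)
Definition filter_second (s : R) i a : R :=
  m%:R * s * vX a + (i == a)%:R * (m%:R * vX i) ^+ 2.

(** In the double sum over rows, the m diagonal pairs give the incoherent term; when i = a, all m^2
    pairs contribute the coherent one. *)
Lemma cexpectation_filter_est2 i a b :
  E[fun w => filter_est i a w * (filter_est i b w)^@] =
  if a == b then (filter_second (vX i) i a)%:C else 0.
Proof.
rewrite (_ : (fun w => _) = (fun w => \sum_(k < m) \sum_(l < m)
    ((X w k a)^@ * X w k i) * ((X w l b)^@ * X w l i)^@)); last first.
  apply/funext => w; rewrite /filter_est mulr_suml; apply: eq_bigr => k _.
  by rewrite raddf_sum/= mulr_sumr.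
have i4 k l : cintegrable P (fun w => ((X w k a)^@ * X w k i) * ((X w l b)^@ * X w l
  i)^@).
  apply: (@cmoments_integrable _ _ _ _ (sigma_mx X)).
  apply: cmomentsM; last apply: cmoments_conjc;
    by apply: cmomentsM => //; exact: cmoments_conjc.
rewrite cexpectation_sum; last by move=> k _; apply: cintegrable_sum.
under eq_bigr => k _.
  rewrite cexpectation_sum//.
  under eq_bigr do rewrite (cexpectation_entry4 vX0 gX).
  over.
case: eqP => _; last by rewrite big1// => k _; rewrite big1.
under eq_bigr do rewrite -rmorph_sum.
rewrite -rmorph_sum/=; congr (_%:C).
under eq_bigr => k _.
  rewrite big_split/= (bigD1 k)//= eqxx mul1r big1 ?addr0; last first.
    by move=> l lk; rewrite eq_sym (negbTE lk) mul0r.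
  rewrite sum_ord_const.
  over.
by rewrite sum_ord_const /filter_second; ring.
Qed.

Let cross i a b : E[fun w => filter_err i a w * (filter_est i b w)^@] = 0.
Proof.
rewrite (_ : (fun w => _) = (fun w => \sum_(k < m) Z w k i * ((X w k a)^@ * (filter_est
  i b w)^@))); last first.
  by apply/funext => w; rewrite mulr_suml; apply: eq_bigr => k _; rewrite mulrA.
have mW k : cmoments P (sigma_mx X) (fun w => (X w k a)^@ * (filter_est i b w)^@).
  by apply: cmomentsM; apply: cmoments_conjc => //; exact: filter_est_cmoments.
rewrite cexpectation_sum; last by move=> k _; exact: (indepM (mW k) (eZ k i)).1.
rewrite big1// => k _; rewrite (indepM (mW k) (eZ k i)).2.
by rewrite (cexpectation_entry vZ0 gZ) mul0r.
Qed.

Let icU V W : cmoments P (sigma_mx X `|` sigma_mx Z) V ->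
  cmoments P (sigma_mx X `|` sigma_mx Z) W -> cintegrable P (fun w => V w * (W w)^@).
Proof.
move=> mV mW; apply: (@cmoments_integrable _ _ _ _ (sigma_mx X `|` sigma_mx Z)).
by apply: cmomentsM => //; exact: cmoments_conjc.
Qed.

Let estU i a := XU (filter_est_cmoments i a).

Lemma cexpectation_filter_out_est i a b :
  E[fun w => filter_out i a w * (filter_est i b w)^@] =
  if a == b then (filter_second (vX i) i a)%:C else 0.
Proof.
rewrite (_ : (fun w => _) = (fun w => filter_est i a w * (filter_est i b w)^@ +
    filter_err i a w * (filter_est i b w)^@)); last first.
  by apply/funext => w; rewrite filter_outE mulrDl.
by rewrite cexpectationD ?cross ?addr0 ?cexpectation_filter_est2//; exact: icU.
Qed.

(** The cross terms vanish because the error is centred and independent of the estimate, so the two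
    second moments add up. *)
Lemma cexpectation_filter_out2 i a b :
  E[fun w => filter_out i a w * (filter_out i b w)^@] =
  if a == b then (filter_second (vX i + vZ i) i a)%:C else 0.
Proof.
have mo := filter_out_cmoments; have me := filter_err_cmoments.
rewrite (_ : (fun w => _) = (fun w => filter_out i a w * (filter_est i b w)^@ +
    ((filter_err i b w * (filter_est i a w)^@)^@ + filter_err i a w * (filter_err i b
      w)^@))); last first.
  apply/funext => w; rewrite !filter_outE conjcD conjcM conjc_invol.
  by rewrite !mulrDr !mulrDl; ring.
have iec x y : cintegrable P (fun w => filter_err i x w * (filter_est i y w)^@) by
  exact: icU.
rewrite cexpectationD; [|exact: icU|]; last first.
  by apply: cintegrableD; [apply: cintegrable_conjc|exact: icU].
rewrite cexpectationD; [|apply: cintegrable_conjc; exact: iec|exact: icU].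
rewrite cexpectation_conjc// cross conjc0 add0r cexpectation_filter_out_est.
(* The error column is the uncorrelated family, of variance [vZ i]; it raises the variance in the
   incoherent term from [vX i] to [vX i + vZ i]. *)
have [|||||_ ->] := @cexpectation_bilinear _ _ _ P (sigma_mx Z) (sigma_mx X) _
  (fun k w => Z w k i) (fun k w => Z w k i) (fun k w => (X w k a)^@)
  (fun k w => (X w k b)^@) (fun=> (vZ i)%:C) (indep_genC XZ).
- move=> k l; have mkl : cmoments P (sigma_mx Z) (fun w => Z w k i * (Z w l i)^@).
    by apply: cmomentsM => //; exact: cmoments_conjc.
  by have [] := mkl.
- move=> k l; apply: (@cmoments_integrable _ _ _ _ (sigma_mx Z)).
  by apply: cmomentsM => //; exact: cmoments_conjc.
- move=> k l; have mkl : cmoments P (sigma_mx X) (fun w => (X w k a)^@ * ((X w l b)^@)^@).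
    by apply: cmomentsM; do ?exact: cmoments_conjc; apply: cmoments_conjc; exact:
      cmoments_conjc.
  by have [] := mkl.
- move=> k l; apply: (@cmoments_integrable _ _ _ _ (sigma_mx X)).
  by apply: cmomentsM; do ?exact: cmoments_conjc; apply: cmoments_conjc; exact:
    cmoments_conjc.
- by move=> k l; rewrite (cexpectation_entry2 vZ0 gZ) eqxx andbT.
- rewrite -mulr_sumr.
  under eq_bigr => k _.
    rewrite (_ : (fun w => _) = (fun w => (X w k a)^@ * X w k b)); last first.
      by apply/funext => w; rewrite conjc_invol.
    rewrite cexpectation_conj_entry2 eqxx/=; over.
  rewrite sum_ord_const [b == a]eq_sym.
  case: eqP => [->|_]; last by rewrite !mulr0 addr0.
  rewrite natrC -!realCM -realCD; congr (_%:C).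
  by rewrite /filter_second; ring.
Qed.

End matched_filter.

(** * The lower bound on the ergodic rate *)

Section rate_bound.
Context d (T : measurableType d) (R : realType) (P : probability T R).
Local Notation integ f := (P.-integrable setT (EFin \o f)).
Local Notation "'E[' Z ]" := (cexpectation P Z) (format "'E[' Z ]").

(** Only [g] is integrable and the mean of [f] may be infinite, so the comparison goes through the
    positive part of [g]. *)
Lemma integrable_ge0_le_expectation (f g : T -> R) :
  measurable_fun setT f -> (forall w, 0 <= f w) -> integ g ->
  (forall w, g w <= f w) -> ((fine 'E_P[g])%:E <= 'E_P[f])%E.
Proof.
move=> mf f0 ig gf.
have fin : (\int[P]_w (g w)%:E)%E \is a fin_num by exact: integrable_fin_num ig.
have mg := measurable_int _ ig.
rewrite unlock fineK// integralE.
apply: (@le_trans _ _ (\int[P]_w (EFin \o g)^\+ w)%E).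
  rewrite leeBlDr; last exact: integrable_neg_fin_num.
  by rewrite leeDl// integral_ge0.
apply: ge0_le_integral => //.
- exact: measurable_funepos.
- exact/measurable_EFinP.
- move=> w _; rewrite funeposE/= -EFin_max lee_fin ge_max gf/=.
  exact: f0.
Qed.

Lemma ln_ge_1BV (x : R) : 0 < x -> 1 - x^-1 <= ln x.
Proof.
move=> x0; have : ln (1 + (x^-1 - 1)) <= x^-1 - 1.
  by apply: le_ln1Dx; rewrite ltrBrDl subrr invr_gt0.
by rewrite addrC subrK lnV ?posrE//; lra.
Qed.

(* The error of the scalar linear estimate [c * u] of [1] from an observation
   with noise power [D] is at least the minimal one, [D / (D + |u|^2)]. *)
Lemma linear_estimate_error (a b c D : R) : 0 < D ->
  D / (D + (a ^+ 2 + b ^+ 2)) <= (1 - 2 * c * a + c ^+ 2 * (a ^+ 2 + b ^+ 2)) + c ^+ 2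
    * D.
Proof.
move=> D0; have Dp : 0 < D + (a ^+ 2 + b ^+ 2) by rewrite ltr_wpDr// addr_ge0 ?sqr_ge0.
rewrite ler_pdivrMr// -subr_ge0.
(* Once the denominator is cleared, the difference is the squared modulus of u - c (D + |u|^2),
   where u = a + ib. *)
rewrite [leRHS](_ : _ = (a - c * (a ^+ 2 + b ^+ 2) - c * D) ^+ 2 + b ^+ 2); last by ring.
by rewrite addr_ge0 ?sqr_ge0.
Qed.

(* Jensen's inequality for [- log2], applied to the error of the linear
   estimate with the coefficient [c] that minimizes the mean error. *)
Lemma expectation_log2_ge (h : T -> R[i]) (D : T -> R) (q m : R) :
  0 <= q -> (forall w, 0 < D w) -> cintegrable P h ->
  complex.Re E[h] = m -> integ (fun w => abs2 (h w)) -> integ D ->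
  let Q := q * fine 'E_P[fun w => abs2 (h w)] + fine 'E_P[D] in
  0 < Q - q * m ^+ 2 ->
  ((log2 (1 + q * m ^+ 2 / (Q - q * m ^+ 2)))%:E <=
   'E_P[fun w => log2 (1 + q * abs2 (h w) / D w)])%E.
Proof.
move=> q0 D0 ih mE ia iD Q Qm.
have ln20 : 0 < ln (2 : R) by rewrite ln_gt0// ltr1n.
have Q0 : 0 < Q by apply: (lt_le_trans Qm); rewrite lerBlDr lerDl mulr_ge0 ?sqr_ge0.
(* This minimizes the mean error 1 - 2 c sqrt(q) m + c^2 Q, and the minimum is [e]. *)
pose c := Num.sqrt q * m / Q.
pose e := (Q - q * m ^+ 2) / Q.
have e0 : 0 < e by rewrite divr_gt0.
pose Y w := (1 - 2 * c * (Num.sqrt q * complex.Re (h w)) + c ^+ 2 * (q * abs2 (h w))) +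
  c ^+ 2 * D w.
pose s w := q * abs2 (h w) / D w.
have s0 w : 0 <= s w by rewrite divr_ge0 ?mulr_ge0 ?abs2_ge0// ltW.
(* The tangent line of -log2 at [e], evaluated at [Y]. Since E[Y] = e, its mean is -log2 e, which is
   the claimed bound. *)
pose g w := (ln 2)^-1 * (- ln e + 1) + (- (ln 2)^-1 / e) * Y w.
have ir : integ (fun w => complex.Re (h w)) by have [] := ih.
have i1 r : integ (fun=> r) by exact: finite_measure_integrable_cst.
have iDD (f1 f2 : T -> R) : integ f1 -> integ f2 -> integ (fun w => f1 w + f2 w).
  by move=> if1 if2; have := integrableD measurableT if1 if2; congr (_.-integrable _ _).
have YE : Y = (fun w => (1 + (- 2 * c * Num.sqrt q) * complex.Re (h w)) +
    ((c ^+ 2 * q) * abs2 (h w) + c ^+ 2 * D w)).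
  by apply/funext => w; rewrite /Y; ring.
have iY : integ Y.
  by rewrite YE; apply: (iDD _ _); apply: (iDD _ _) => //; exact: integZ.
have EY : fine 'E_P[Y] = e.
  rewrite YE !fine_expectationD//; try (by apply: (iDD _ _) => //; exact: integZ); try
    exact: integZ.
  rewrite !fine_expectationZ// expectation_cst/=.
  have -> : fine 'E_P[fun w => complex.Re (h w)] = m by rewrite -mE.
  have -> : fine 'E_P[D] = Q - q * fine 'E_P[fun w => abs2 (h w)] by rewrite /Q; ring.
  have sq : Num.sqrt q ^+ 2 = q by rewrite sqr_sqrtr.
  have key (r A B : R) : B != 0 -> 1 + - 2 * (r * m / B) * r * m +
      ((r * m / B) ^+ 2 * r ^+ 2 * A + (r * m / B) ^+ 2 * (B - r ^+ 2 * A)) =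
      (B - r ^+ 2 * m ^+ 2) / B by move=> B0; field.
  have := key (Num.sqrt q) (fine 'E_P[fun w => abs2 (h w)]) Q.
  by rewrite sq; apply; rewrite gt_eqF.
have ig : integ g by apply: (iDD _ _) => //; exact: integZ.
have gE : fine 'E_P[g] = log2 (1 + q * m ^+ 2 / (Q - q * m ^+ 2)).
  rewrite fine_expectationD//; last exact: integZ.
  rewrite !fine_expectationZ// expectation_cst/= EY /log2.
  have -> : 1 + q * m ^+ 2 / (Q - q * m ^+ 2) = e^-1.
    by rewrite /e; field; rewrite !gt_eqF.
  rewrite lnV ?posrE//; field.
  by rewrite !gt_eqF.
rewrite -gE; apply: integrable_ge0_le_expectation => //.
- have mD : measurable_fun setT D.
    by apply/measurable_EFinP; exact: measurable_int iD.
  have ma : measurable_fun setT (fun w => q * abs2 (h w)).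
    by apply/measurable_EFinP; exact: measurable_int (integZ q ia).
  rewrite (_ : (fun w => _) = (fun w => (ln (D w + q * abs2 (h w)) - ln (D w)) / ln 2)).
    apply: measurable_funM => //; apply: measurable_funB.
      apply: measurableT_comp; first exact: measurable_ln.
      exact: measurable_funD.
    by apply: measurableT_comp => //; exact: measurable_ln.
  apply/funext => w; rewrite /log2; congr (_ / _).
  rewrite -ln_div ?posrE// ?ltr_wpDr ?mulr_ge0 ?abs2_ge0//; congr ln.
  by field; rewrite gt_eqF.
- by move=> w; rewrite divr_ge0 ?ln_ge0 ?ler1n// lerDl; exact: s0.
move=> w; rewrite /g /log2 -/(s w).
have s1 : 0 < 1 + s w by rewrite ltr_wpDr.
have Yge : (1 + s w)^-1 <= Y w.
  have := linear_estimate_error (Num.sqrt q * complex.Re (h w)) (Num.sqrt q *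
    complex.Im (h w)) c (D0 w).
  have -> : (Num.sqrt q * complex.Re (h w)) ^+ 2 + (Num.sqrt q * complex.Im (h w)) ^+ 2 =
      q * abs2 (h w) by rewrite !exprMn sqr_sqrtr// -mulrDr.
  apply: le_trans.
  rewrite le_eqVlt; apply/orP; left; apply/eqP; rewrite /s; field.
  rewrite !gt_eqF//; first by rewrite ltr_wpDr ?mulr_ge0 ?abs2_ge0.
(* The tangent inequality at (1 + s) e; the estimation error then bounds (1 + s)^-1 by [Y]. *)
have := ln_ge_1BV (mulr_gt0 s1 e0).
rewrite lnM ?posrE// invfM => H.
rewrite ler_pdivlMr//.
have -> : ((ln 2)^-1 * (- ln e + 1) + - (ln 2)^-1 / e * Y w) * ln 2 =
    - ln e + 1 - Y w / e.
  by field; rewrite !gt_eqF.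
have : (1 + s w)^-1 / e <= Y w / e by rewrite ler_pM2r ?invr_gt0.
lra.
Qed.

Lemma cexpectation_abs2 (Z : T -> R[i]) (v : R) :
  cintegrable P (fun w => Z w * (Z w)^@) -> E[fun w => Z w * (Z w)^@] = v%:C ->
  integ (fun w => abs2 (Z w)) /\ fine 'E_P[fun w => abs2 (Z w)] = v.
Proof.
rewrite (_ : (fun w => _) = (fun w => (abs2 (Z w))%:C)); last first.
  by apply/funext => w; rewrite -abs2E.
move=> [iZ _]; rewrite cexpectation_real => /complexI <-.
by split.
Qed.

(** Integrability is part of the notion because [cexpectation] would read an infinite mean as 0. *)
Definition second_moment (Z : T -> R[i]) (v : R) : Prop :=
  cintegrable P (fun w => Z w * (Z w)^@) /\ E[fun w => Z w * (Z w)^@] = v%:C.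

(** Of [al] only the pairwise products are controlled, since for the user data nothing beyond the
    correlation matrix is known. *)
Lemma second_moment_bilinear G H (I : finType) (al be : I -> T -> R[i])
    (s v : I -> R) :
  indep_gen P G H ->
  (forall a b, cmeas G (fun w => al a w * (al b w)^@)) ->
  (forall a b, cintegrable P (fun w => al a w * (al b w)^@)) ->
  (forall a b, E[fun w => al a w * (al b w)^@] = if a == b then (s a)%:C else 0) ->
  (forall a, cmoments P H (be a)) -> (forall a, second_moment (be a) (v a)) ->
  second_moment (fun w => \sum_a al a w * be a w) (\sum_a s a * v a).
Proof.
move=> GH mal ial Eal mbe sbe.
have mb a b : cmoments P H (fun w => be a w * (be b w)^@).
  by apply: cmomentsM => //; exact: cmoments_conjc.
have [||iZ EZ] := cexpectation_bilinear (al' := al) (be := be) (be' := be)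
  (s := fun a => (s a)%:C) GH mal ial _ _ Eal.
- by move=> a b; have [] := mb a b.
- by move=> a b; exact: cmoments_integrable (mb a b).
split => //; rewrite EZ raddf_sum/=; apply: eq_bigr => a _.
by rewrite (sbe a).2 realCM.
Qed.

End rate_bound.

(** * Pairing of users and the precoder *)

Section users.
Variable K : nat.
Implicit Types a b k : 'I_(K.*2).

Lemma partnerK : involutive (@partner K).
Proof.
move=> a; apply/val_inj => /=; case: ifP; case: ifP; lia.
Qed.

Lemma half_partner a : ((partner a)./2 = a./2)%N.
Proof. by rewrite /=; case: ifP; lia. Qed.

Lemma odd_partner a : odd (partner a) = ~~ odd a.
Proof. by rewrite /=; case: ifP; lia. Qed.

Lemma partner_neq a : partner a != a.
Proof. by apply/eqP => /(congr1 (fun a : 'I__ => odd a)); rewrite odd_partner; case: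
  (odd a). Qed.

Lemma eq_partner a b : (b == partner a) = ((a./2 == b./2) && (odd a != odd b)).
Proof.
apply/eqP/andP => [->|[h o]].
  by rewrite half_partner odd_partner eqxx; case: (odd a).
by apply/ord_inj => /=; case: ifP; lia.
Qed.

Lemma eq_partnerC a b : (b == partner a) = (a == partner b).
Proof. by rewrite !eq_partner eq_sym; case: (odd a); case: (odd b). Qed.

Lemma sum_users (R : nmodType) (f : 'I_(K.*2) -> R) :
  \sum_a f a = \sum_(m < K) (f (fst_user m) + f (snd_user m)).
Proof.
pose h (z : 'I_K * bool) := if z.2 then snd_user z.1 else fst_user z.1.
have half_lt a : (a./2 < K)%N by rewrite ltn_half_double.
pose g a := (Ordinal (half_lt a), odd a).
rewrite (reindex h); last first.
  exists g => [[m b] _|a _].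
    rewrite /h /g; congr (_, _); first apply/val_inj; case: b => /=.
    - by rewrite uphalf_double.
    - by rewrite doubleK.
    - by rewrite odd_double.
    - by rewrite odd_double.
  apply/val_inj; rewrite /h /g /=; have := odd_double_half a.
  by case: (odd a).
rewrite -(pair_big xpredT xpredT (fun m (z : bool) => f (h (m, z))))/=.
by apply: eq_bigr => m _; rewrite big_bool/= addrC.
Qed.

Lemma partner_fst (m : 'I_K) : partner (fst_user m) = snd_user m.
Proof. by apply/val_inj; rewrite /= odd_double. Qed.

Lemma partner_snd (m : 'I_K) : partner (snd_user m) = fst_user m.
Proof. by apply/val_inj; rewrite /= odd_double. Qed.

(** Each factor has the shape of [filter_second], an incoherent part plus a spike at one user. The
    two spikes meet only when i is the partner of k. *)
Lemma sum_users_delta (R : comPzRingType) (f g : 'I_(K.*2) -> R) (A B C D : R) k i :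
  \sum_a (A * f a + (k == a)%:R * B) * (C * g (partner a) + (i == partner a)%:R * D) =
  A * C * (\sum_a f a * g (partner a)) + A * D * f (partner i) +
  B * C * g (partner k) + (i == partner k)%:R * B * D.
Proof.
rewrite (eq_bigr (fun a => (A * C) * (f a * g (partner a)) +
  (if a == partner i then A * D * f a else 0) +
  (if a == k then B * C * g (partner a) + (i == partner a)%:R * B * D else 0))); last
    first.
  move=> a _; rewrite [k == a]eq_sym [i == partner a]eq_partnerC.
  by case: (a == partner i); case: (a == k); rewrite /= ?mulr1n ?mulr0n; ring.
by rewrite !big_split/= -mulr_sumr -!big_mkcond/= !big_pred1_eq addrA.
Qed.

End users.

Section relay_matrix.
Context {R : realType} {K N : nat} d (T : measurableType d) (S : relay_rvs R K N T).

Lemma TmxE (a b : 'I_(K.*2)) : (Tmx a b : R[i]) = (b == partner a)%:R.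
Proof.
rewrite !mxE eq_partner; case: ifP => //= _.
by congr (nat_of_bool _)%:R; case: (odd a); case: (odd b); rewrite -val_eqE /= !inordK.
Qed.

Lemma mul_Tmx m n (A : 'M[R[i]]_(m, K.*2)) (B : 'M[R[i]]_(K.*2, n)) i j :
  (A *m Tmx *m B) i j = \sum_a A i a * B (partner a) j.
Proof.
rewrite -mulmxA mxE; apply: eq_bigr => a _; congr (_ * _).
rewrite mxE (bigD1 (partner a))//= TmxE eqxx mul1r big1 ?addr0// => b /negbTE ba.
by rewrite TmxE ba mul0r.
Qed.

Lemma herm_mxE m n (A : 'M[R[i]]_(m, n)) i j : herm_mx A i j = (A j i)^@.
Proof. by rewrite !mxE. Qed.

Lemma WE w i j :
  W S w i j = \sum_a (Fhat S w i a)^@ * (Ghat S w j (partner a))^@.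
Proof. by rewrite mul_Tmx; apply: eq_bigr => a _; rewrite herm_mxE mxE. Qed.

Lemma mul_W m (A : 'M[R[i]]_(N, m)) w i j : (W S w *m A) i j =
  \sum_a (Fhat S w i a)^@ * (\sum_k (Ghat S w k (partner a))^@ * A k j).
Proof.
rewrite /W -mulmxA mul_Tmx; apply: eq_bigr => a _; rewrite mxE; congr (_ * _).
by rewrite mxE; apply: eq_bigr => k _; rewrite herm_mxE.
Qed.

Lemma mulmx_W m (A : 'M[R[i]]_(m, N)) w i j : (A *m W S w) i j =
  \sum_a (\sum_k (Fhat S w k a)^@ * A i k) * (Ghat S w j (partner a))^@.
Proof.
rewrite /W !mulmxA mul_Tmx; apply: eq_bigr => a _; rewrite herm_mxE; congr (_ * _).
by rewrite mxE; apply: eq_bigr => k _; rewrite mulrC mxE.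
Qed.

Lemma mulmx_W_mulmx m n (A : 'M[R[i]]_(m, N)) (B : 'M[R[i]]_(N, n)) w i j :
  (A *m W S w *m B) i j = \sum_a (\sum_k (Fhat S w k a)^@ * A i k) *
    (\sum_k (Ghat S w k (partner a))^@ * B k j).
Proof.
rewrite /W !mulmxA -mulmxA mul_Tmx; apply: eq_bigr => a _; congr (_ * _).
  by rewrite mxE; apply: eq_bigr => k _; rewrite mulrC mxE.
by rewrite mxE; apply: eq_bigr => k _; rewrite herm_mxE.
Qed.

End relay_matrix.

(** * Second moments of random vectors and squared norms *)

Section random_vectors.
Context d (T : measurableType d) (R : realType) (P : probability T R).
Local Notation integ f := (P.-integrable setT (EFin \o f)).
Local Notation "'E[' Z ]" := (cexpectation P Z) (format "'E[' Z ]").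

Lemma cmeas_sigma_mx m n (X : T -> 'M[R[i]]_(m, n)) a i : cmeas (sigma_mx X) (fun w =>
  X w a i).
Proof.
exact: (cmeas_sigma_of (Z := fun (ij : 'I_m * 'I_n) w => X w ij.1 ij.2) (a, i)
  (@sub_sigma_algebra _ _ _)).
Qed.

Lemma sigma_mx_measurable m n (X : T -> 'M[R[i]]_(m, n)) :
  cmeasurable_mx X -> sigma_mx X `<=` measurable.
Proof. by move=> mX; apply: sigma_of_measurable => -[a i]; exact: mX. Qed.

(** A nonzero diagonal entry rules out an infinite mean of |X_a|^2, as [fine] would turn it into 0.
    The products of distinct entries are then integrable because both parts of z conj(w) are at most
    |z|^2 + |w|^2 in absolute value. *)
Lemma correlation_mx_uncorrelated n (X : T -> 'cV[R[i]]_n) (r : R) :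
  cmeasurable_mx X -> r != 0 -> correlation_mx P X = (r%:C)%:M ->
  (forall a b, cintegrable P (fun w => X w a 0 * (X w b 0)^@)) /\
  (forall a b, E[fun w => X w a 0 * (X w b 0)^@] = if a == b then r%:C else 0).
Proof.
move=> mX r0 XE.
have EX a b : E[fun w => X w a 0 * (X w b 0)^@] = if a == b then r%:C else 0.
  have := congr1 (fun A : 'M[R[i]]_n => A a b) XE; rewrite !mxE.
  rewrite (_ : (fun w => _) = (fun w => X w a 0 * (X w b 0)^@)); last first.
    by apply/funext => w; rewrite mxE big_ord1 herm_mxE.
  by move=> ->; case: eqP.
have mG := sigma_mx_measurable mX.
have mp a b : cmeas (sigma_mx X) (fun w => X w a 0 * (X w b 0)^@).
  by apply: cmeasM; [|apply: cmeas_conjc]; exact: cmeas_sigma_mx.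
have ia a : integ (fun w => abs2 (X w a 0)).
  have ma := measurable_abs2 1 (mX a 0).
  have : fine 'E_P[fun w => abs2 (X w a 0)] = r.
    have := EX a a; rewrite eqxx (_ : (fun w => _) = (fun w => (abs2 (X w a 0))%:C)).
      by rewrite cexpectation_real => /complexI.
    by apply/funext => w; rewrite abs2E.
  rewrite unlock => Er; apply/integrableP; split; first exact/measurable_EFinP.
  rewrite (eq_integral (fun w => (abs2 (X w a 0))%:E)); last first.
    by move=> w _; rewrite /= ger0_norm ?abs2_ge0.
  rewrite -ge0_fin_numE; last by apply: integral_ge0 => w _; rewrite lee_fin abs2_ge0.
  apply/negPn/negP => H; move: r0 H; rewrite -Er.
  by case: (\int[P]_w _)%E => [x _|/=|/=]; rewrite ?eqxx.
split => // a b; have [mr mi] := cmeas_cmeasurable mG (mp a b).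
have i2 : integ (fun w => abs2 (X w a 0) + abs2 (X w b 0)).
  by have := integrableD measurableT (ia a) (ia b); congr (_.-integrable _ _).
split; apply: (le_integ _ _ i2) => // w; case: (X w a 0) => x y; case: (X w b 0) => z t;
  rewrite /abs2/= ler_norml; apply/andP; split.
- by have := sqr_ge0 (x + z); have := sqr_ge0 (y + t); nra.
- by have := sqr_ge0 (x - z); have := sqr_ge0 (y - t); nra.
- by have := sqr_ge0 (x - t); have := sqr_ge0 (y + z); nra.
- by have := sqr_ge0 (x + t); have := sqr_ge0 (y - z); nra.
Qed.

Lemma gaussian_vec_cmeasurable n (X : T -> 'cV[R[i]]_n) :
  gaussian_vec P X -> cmeasurable_mx X.
Proof.
move=> gX a j; rewrite (ord1 j); split.
- have [v [_ [mX _]]] := gX (delta_mx 0 a); move: mX.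
  by congr measurable_fun; apply/funext => w; rewrite -rowE mxE.
(* The coefficient -i turns the imaginary part of the entry into a real part. *)
- have [v [_ [mX _]]] := gX ((0 +i* (-1)) *: delta_mx 0 a); move: mX.
  congr measurable_fun; apply/funext => w; rewrite -scalemxAl -rowE !mxE.
  by case: (X w a 0) => x y /=; rewrite mul0r mulN1r opprK add0r.
Qed.

Definition has_mean (f : T -> R) (v : R) : Prop := integ f /\ fine 'E_P[f] = v.

Lemma has_mean_cst r : has_mean (fun=> r) r.
Proof. by split; [exact: finite_measure_integrable_cst|rewrite expectation_cst]. Qed.

Lemma has_meanD f g u v : has_mean f u -> has_mean g v -> has_mean (fun w => f w + g w)
  (u + v).
Proof.
move=> [fi <-] [gi <-]; split; last exact: fine_expectationD.
by have := integrableD measurableT fi gi; congr (_.-integrable _ _).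
Qed.

Lemma has_meanZ f r u : has_mean f u -> has_mean (fun w => r * f w) (r * u).
Proof. by move=> [fi <-]; split; [exact: integZ|exact: fine_expectationZ]. Qed.

Lemma has_mean_sum (I : Type) (s : seq I) (Q : pred I) (f : I -> T -> R) (v : I -> R) :
  (forall i, Q i -> has_mean (f i) (v i)) ->
  has_mean (fun w => \sum_(i <- s | Q i) f i w) (\sum_(i <- s | Q i) v i).
Proof.
move=> fv; elim: s => [|i s IH].
  rewrite big_nil (_ : (fun w => _) = (fun=> 0)); first exact: has_mean_cst.
  by apply/funext => w; rewrite big_nil.
rewrite big_cons; case: ifPn => Qi.
  rewrite (_ : (fun w => _) = (fun w => f i w + \sum_(i <- s | Q i) f i w)).
    by apply: has_meanD => //; exact: fv.
  by apply/funext => w; rewrite big_cons Qi.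
rewrite (_ : (fun w => _) = (fun w => \sum_(i <- s | Q i) f i w))//.
by apply/funext => w; rewrite big_cons (negbTE Qi).
Qed.

Lemma second_moment_abs2 (Z : T -> R[i]) v : second_moment P Z v -> has_mean (fun w =>
  abs2 (Z w)) v.
Proof. by move=> [iZ EZ]; exact: cexpectation_abs2. Qed.

Lemma second_moment_norm2 m n (A : T -> 'M[R[i]]_(m, n)) (v : 'I_m -> 'I_n -> R) :
  (forall i j, second_moment P (fun w => A w i j) (v i j)) ->
  has_mean (fun w => norm2 (A w)) (\sum_i \sum_j v i j).
Proof.
move=> Av; apply: has_mean_sum => i _; apply: has_mean_sum => j _.
exact: second_moment_abs2.
Qed.

Lemma second_momentZ (Z : T -> R[i]) (r v : R) : second_moment P Z v ->
  second_moment P (fun w => r%:C * Z w) (r ^+ 2 * v).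
Proof.
move=> [iZ EZ]; rewrite /second_moment.
rewrite (_ : (fun w => _) = (fun w => (r ^+ 2)%:C * (Z w * (Z w)^@))); last first.
  by apply/funext => w; rewrite conjcM conjc_real expr2 realCM; ring.
by split; [exact: cintegrableZ|rewrite cexpectationZ// EZ realCM].
Qed.

Lemma second_moment_conjc (Z : T -> R[i]) (v : R) : second_moment P Z v ->
  second_moment P (fun w => (Z w)^@) v.
Proof.
rewrite /second_moment (_ : (fun w => (Z w)^@ * _) = (fun w => Z w * (Z w)^@))//.
by apply/funext => w; rewrite conjc_invol mulrC.
Qed.

End random_vectors.

(** * Moments of the relay channel *)

Section relay.
Context (R : realType) (d : measure_display) (T : measurableType d)
    (P : probability T R) (K N : nat)
    (c : relay_params R K) (S : relay_rvs R K N T).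
Hypotheses (N_ge1 : (1 <= N)%N) (pow_ge0 : forall k, 0 <= pow c k)
    (pow_R_gt0 : 0 < pow_R c)
    (var_g_ge0 : forall k, 0 <= var_g c k)
    (var_f_ge0 : forall k, 0 <= var_f c k)
    (var_LIR_ge0 : 0 <= var_LIR c)
    (var_nr_ge0 : 0 <= var_nr c)
    (pow_rho_gt0 : 0 < pow_rho c)
    (Ghat_law : cgaussian_mx P (Ghat S) (var_ghat c))
    (Fhat_law : cgaussian_mx P (Fhat S) (var_fhat c))
    (Eg_law : cgaussian_mx P (Eg S) (var_eg c))
    (Ef_law : cgaussian_mx P (Ef S) (var_ef c))
    (GRR_law : cgaussian_mx P (GRR S) (fun _ => var_LIR c))
    (xU_meas : cmeasurable_mx (xU S))
    (xU_corr : correlation_mx P (xU S) = 1%:M)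
    (xR_law : gaussian_vec P (xR S))
    (xR_corr : correlation_mx P (xR S) = (pow_R c / N%:R)%:C%:M)
    (zR_law : cgaussian_mx P (zR S) (fun _ => var_nr c))
    (indep : mutual_indep P (tnth [tuple sigma_mx (Ghat S); sigma_mx (Fhat S);
       sigma_mx (Eg S); sigma_mx (Ef S); sigma_mx (GRR S);
       sigma_mx (xU S); sigma_mx (xR S); sigma_mx (zR S)])).

Local Notation sg := (var_g c).
Local Notation sf := (var_f c).
Local Notation hg := (var_ghat c).
Local Notation hf := (var_fhat c).
Local Notation n := (N%:R : R).
Local Notation "'E[' Z ]" := (cexpectation P Z) (format "'E[' Z ]").

Lemma var_mmse_bounds v : 0 <= v -> 0 <= var_mmse c v <= v.
Proof.
move=> v0; rewrite /var_mmse.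
have x0 : 0 <= (tau c)%:R * pow_rho c by rewrite mulr_ge0 ?ler0n ?ltW.
have y0 : 0 < (tau c)%:R * pow_rho c * v + 1 by rewrite ltr_wpDl // mulr_ge0.
apply/andP; split; first by rewrite divr_ge0 ?mulr_ge0 ?sqr_ge0// ltW.
rewrite ler_pdivrMr//; have := mulr_ge0 x0 (sqr_ge0 v); lra.
Qed.

Lemma var_ghat_ge0 i : 0 <= hg i.
Proof. by have /andP[] := var_mmse_bounds (var_g_ge0 i). Qed.
Lemma var_fhat_ge0 i : 0 <= hf i.
Proof. by have /andP[] := var_mmse_bounds (var_f_ge0 i). Qed.
Lemma var_eg_ge0 i : 0 <= var_eg c i.
Proof. by have /andP[_] := var_mmse_bounds (var_g_ge0 i); rewrite subr_ge0. Qed.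
Lemma var_ef_ge0 i : 0 <= var_ef c i.
Proof. by have /andP[_] := var_mmse_bounds (var_f_ge0 i); rewrite subr_ge0. Qed.

(** * Independence between groups of blocks *)

Let blk : 'I_8 -> set (set T) := tnth [tuple sigma_mx (Ghat S); sigma_mx (Fhat S);
       sigma_mx (Eg S); sigma_mx (Ef S); sigma_mx (GRR S);
       sigma_mx (xU S); sigma_mx (xR S); sigma_mx (zR S)].
(* Generates the sigma-algebra of the blocks whose positions are listed in s. *)
Let U (s : seq nat) := \bigcup_(i in [set i : 'I_8 | (i : nat) \in s]) blk i.

Let blk_m i : blk i `<=` measurable.
Proof.
rewrite /blk (tnth_nth set0); case: i.
case=> [|[|[|[|[|[|[|[|m]]]]]]]] //= _; apply: sigma_mx_measurable => //.
- exact: cgaussian_mx_cmeasurable Ghat_law.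
- exact: cgaussian_mx_cmeasurable Fhat_law.
- exact: cgaussian_mx_cmeasurable Eg_law.
- exact: cgaussian_mx_cmeasurable Ef_law.
- exact: cgaussian_mx_cmeasurable GRR_law.
- exact: gaussian_vec_cmeasurable xR_law.
- exact: cgaussian_mx_cmeasurable zR_law.
Qed.

Let blkI i : setI_closed (blk i).
Proof.
rewrite /blk (tnth_nth set0); case: i.
by case=> [|[|[|[|[|[|[|[|m]]]]]]]] //= _; exact: sigma_of_setI.
Qed.

Let blkT i : blk i setT.
Proof.
rewrite /blk (tnth_nth set0); case: i.
by case=> [|[|[|[|[|[|[|[|m]]]]]]]] //= _; exact: sigma_of_setT.
Qed.

Let U_m s : U s `<=` measurable.
Proof. by apply: bigcup_sub => i _; exact: blk_m. Qed.

Let blkU s (i : 'I_8) : (i : nat) \in s -> blk i `<=` <<s U s>>.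
Proof. by move=> si A Ai; apply: sub_sigma_algebra; exists i. Qed.

(** Groups are lists of numbers so that their disjointness is settled by computation. *)
Let indepU s s' : all (fun i => i \notin s') s -> indep_gen P (U s) (U s').
Proof.
move=> /allP ss'; apply: (@mutual_indep_grouping _ _ _ P _ blk blk_m blkI blkT indep
  (fun i => (i : nat) \in s) (fun i => (i : nat) \in s')) => i; exact: ss'.
Qed.

Let indep_blk (i j : 'I_8) : i != j -> indep_gen P (blk i) (blk j).
Proof.
move=> ij; apply: (@indep_gen_sub _ _ _ _ _ (U [:: i : nat]) _ (U [:: j : nat])).
- by apply: blkU; rewrite mem_head.
- by apply: blkU; rewrite mem_head.
- by apply: indepU; rewrite /= inE ij.
Qed.

Let upU s (i : 'I_8) Z : (i : nat) \in s -> cmoments P (blk i) Z -> cmoments P (U s) Z.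
Proof. by move=> si; apply: cmoments_sub => //; exact: blkU. Qed.

Let o j (h : (j < 8)%N) : 'I_8 := Ordinal h.

Let Ghat_U s a i : 0%N \in s -> cmoments P (U s) (fun w => Ghat S w a i).
Proof. by move=> s0; apply: (upU (i := @o 0 isT)) => //; exact: (cmoments_entry
  var_ghat_ge0 Ghat_law). Qed.
Let Fhat_U s a i : 1%N \in s -> cmoments P (U s) (fun w => Fhat S w a i).
Proof. by move=> s0; apply: (upU (i := @o 1 isT)) => //; exact: (cmoments_entry
  var_fhat_ge0 Fhat_law). Qed.
Let Eg_U s a i : 2%N \in s -> cmoments P (U s) (fun w => Eg S w a i).
Proof. by move=> s0; apply: (upU (i := @o 2 isT)) => //; exact: (cmoments_entry
  var_eg_ge0 Eg_law). Qed.
Let Ef_U s a i : 3%N \in s -> cmoments P (U s) (fun w => Ef S w a i).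
Proof. by move=> s0; apply: (upU (i := @o 3 isT)) => //; exact: (cmoments_entry
  var_ef_ge0 Ef_law). Qed.
Let GRR_U s a i : 4%N \in s -> cmoments P (U s) (fun w => GRR S w a i).
Proof. by move=> s0; apply: (upU (i := @o 4 isT)) => //; exact: (cmoments_entry (fun=>
  var_LIR_ge0) GRR_law). Qed.
Let zR_U s a i : 7%N \in s -> cmoments P (U s) (fun w => zR S w a i).
Proof. by move=> s0; apply: (upU (i := @o 7 isT)) => //; exact: (cmoments_entry (fun=>
  var_nr_ge0) zR_law). Qed.

(** * Moments of the effective channel coefficients *)

Let q i a := filter_out (Ghat S) (Eg S) i a.
Let p i a := filter_out (Fhat S) (Ef S) i a.
Let qe i a := filter_est (Ghat S) i a.
Let pe i a := filter_est (Fhat S) i a.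
Let VF i a := filter_second N hf (sf i) i a.
Let VG i a := filter_second N hg (sg i) i a.
Let VFe i a := filter_second N hf (hf i) i a.
Let VGe i a := filter_second N hg (hg i) i a.

Let GE : indep_gen P (sigma_mx (Ghat S)) (sigma_mx (Eg S)).
Proof. exact: (@indep_blk (@o 0 isT) (@o 2 isT)). Qed.
Let FE : indep_gen P (sigma_mx (Fhat S)) (sigma_mx (Ef S)).
Proof. exact: (@indep_blk (@o 1 isT) (@o 3 isT)). Qed.

Let q_U s i a : 0%N \in s -> 2%N \in s -> cmoments P (U s) (q i a).
Proof.
move=> s0 s2; apply: cmoments_sum => // k _; apply: cmomentsM.
  by apply: cmoments_conjc; exact: Ghat_U.
by apply: cmomentsD; [exact: Ghat_U|exact: Eg_U].
Qed.

Let p_U s i a : 1%N \in s -> 3%N \in s -> cmoments P (U s) (p i a).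
Proof.
move=> s1 s3; apply: cmoments_sum => // k _; apply: cmomentsM.
  by apply: cmoments_conjc; exact: Fhat_U.
by apply: cmomentsD; [exact: Fhat_U|exact: Ef_U].
Qed.

Let qe_U s i a : 0%N \in s -> cmoments P (U s) (qe i a).
Proof.
move=> s0; apply: cmoments_sum => // k _; apply: cmomentsM; last exact: Ghat_U.
by apply: cmoments_conjc; exact: Ghat_U.
Qed.

Let pe_U s i a : 1%N \in s -> cmoments P (U s) (pe i a).
Proof.
move=> s1; apply: cmoments_sum => // k _; apply: cmomentsM; last exact: Fhat_U.
by apply: cmoments_conjc; exact: Fhat_U.
Qed.

Let sgE i : hg i + var_eg c i = sg i. Proof. by rewrite /var_eg; ring. Qed.
Let sfE i : hf i + var_ef c i = sf i. Proof. by rewrite /var_ef; ring. Qed.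

Let q2 i a b : E[fun w => q i a w * (q i b w)^@] = if a == b then (VG i a)%:C else 0.
Proof.
by rewrite (cexpectation_filter_out2 var_ghat_ge0 var_eg_ge0 Ghat_law Eg_law GE) sgE.
Qed.
Let p2 i a b : E[fun w => p i a w * (p i b w)^@] = if a == b then (VF i a)%:C else 0.
Proof.
by rewrite (cexpectation_filter_out2 var_fhat_ge0 var_ef_ge0 Fhat_law Ef_law FE) sfE.
Qed.
Let qe2 i a b : E[fun w => qe i a w * (qe i b w)^@] = if a == b then (VGe i a)%:C else 0.
Proof. exact: (cexpectation_filter_est2 var_ghat_ge0 Ghat_law). Qed.
Let pe2 i a b : E[fun w => pe i a w * (pe i b w)^@] = if a == b then (VFe i a)%:C else 0.
Proof. exact: (cexpectation_filter_est2 var_fhat_ge0 Fhat_law). Qed.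
Let qqe2 i a b : E[fun w => q i a w * (qe i b w)^@] = if a == b then (VGe i a)%:C else 0.
Proof. exact: (cexpectation_filter_out_est var_ghat_ge0 var_eg_ge0 Ghat_law Eg_law GE).
  Qed.
Let ppe2 i a b : E[fun w => p i a w * (pe i b w)^@] = if a == b then (VFe i a)%:C else 0.
Proof. exact: (cexpectation_filter_out_est var_fhat_ge0 var_ef_ge0 Fhat_law Ef_law FE).
  Qed.

Let second_cmoments G Z v : cmoments P G Z -> E[fun w => Z w * (Z w)^@] = v%:C ->
  second_moment P Z v.
Proof.
move=> mZ EZ; split => //; apply: (@cmoments_integrable _ _ _ _ G).
by apply: cmomentsM => //; exact: cmoments_conjc.
Qed.

Let bilin G H (I : finType) (al be : I -> T -> R[i]) (s v : I -> R) :
  indep_gen P G H -> (forall a, cmoments P G (al a)) ->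
  (forall a b, E[fun w => al a w * (al b w)^@] = if a == b then (s a)%:C else 0) ->
  (forall a, cmoments P H (be a)) -> (forall a, second_moment P (be a) (v a)) ->
  second_moment P (fun w => \sum_a al a w * be a w) (\sum_a s a * v a).
Proof.
move=> GH mal Eal; apply: (second_moment_bilinear GH) => // a b.
  by have [] : cmoments P G (fun w => al a w * (al b w)^@)
    by apply: cmomentsM => //; exact: cmoments_conjc.
apply: (@cmoments_integrable _ _ _ _ G).
by apply: cmomentsM => //; exact: cmoments_conjc.
Qed.

(* h k i is the coefficient f_k^T W g_i, and he k i is its analogue with the
   estimated columns of index k and i. *)
Let h k i w := \sum_a p k a w * q i (partner a) w.
Let he k i w := \sum_a pe k a w * qe i (partner a) w.

(** Downlink blocks ([Fhat], [Ef]) against uplink blocks ([Ghat], [Eg]): the two filters inside [h]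
    are independent. *)
Let FG : indep_gen P (U [:: 1; 3]%N) (U [:: 0; 2]%N). Proof. exact: indepU. Qed.

Let q_second i a : second_moment P (q i a) (VG i a).
Proof. by apply: (second_cmoments (q_U _ _ (s := [:: 0; 2]%N) _ _)) => //; rewrite q2
  eqxx. Qed.
Let qe_second i a : second_moment P (qe i a) (VGe i a).
Proof. by apply: (second_cmoments (qe_U _ _ (s := [:: 0; 2]%N) _)) => //; rewrite qe2
  eqxx. Qed.

Lemma h_second k i : second_moment P (h k i) (\sum_a VF k a * VG i (partner a)).
Proof.
by apply: (bilin FG) => [a|a b|a|a]; [exact: p_U|exact: p2|exact: q_U|exact: q_second].
Qed.

Lemma he_second k i : second_moment P (he k i) (\sum_a VFe k a * VGe i (partner a)).
Proof.
by apply: (bilin FG) => [a|a b|a|a]; [exact: pe_U|exact: pe2|exact: qe_U|exact: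
  qe_second].
Qed.

Let mul_U s X Y : cmoments P (U s) X -> cmoments P (U s) Y ->
  cmoments P (U s) (fun w => X w * (Y w)^@).
Proof. by move=> mX mY; apply: cmomentsM => //; exact: cmoments_conjc. Qed.

(* The estimated coefficient is the conditional mean of the true one. *)
Lemma h_he k i : cintegrable P (fun w => h k i w * (he k i w)^@) /\
  E[fun w => h k i w * (he k i w)^@] = (\sum_a VFe k a * VGe i (partner a))%:C.
Proof.
have mp a b : cmoments P (U [:: 1; 3]%N) (fun w => p k a w * (pe k b w)^@).
  by apply: mul_U; [exact: p_U|exact: pe_U].
have mq a b : cmoments P (U [:: 0; 2]%N) (fun w => q i (partner a) w * (qe i (partner
  b) w)^@).
  by apply: mul_U; [exact: q_U|exact: qe_U].
have [||||iZ EZ] := cexpectation_bilinear (al := p k) (al' := pe k)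
  (be := fun a => q i (partner a)) (be' := fun a => qe i (partner a))
  (s := fun a => (VFe k a)%:C) FG _ _ _ _ (ppe2 k).
- by move=> a b; have [] := mp a b.
- by move=> a b; exact: cmoments_integrable (mp a b).
- by move=> a b; have [] := mq a b.
- by move=> a b; exact: cmoments_integrable (mq a b).
split => //; rewrite EZ raddf_sum/=; apply: eq_bigr => a _.
by rewrite qqe2 eqxx realCM.
Qed.

(** Pythagoras: the inner product of [h] with [he] equals the second moment of [he], so each cross
    term cancels one copy of it. *)
Lemma h_he_second k i : second_moment P (fun w => h k i w - he k i w)
  (\sum_a VF k a * VG i (partner a) - \sum_a VFe k a * VGe i (partner a)).
Proof.
have [ih Eh] := h_second k i; have [ie Ee] := he_second k i; have [ic Ec] := h_he k i.
have cN1 : (-1 : R[i])^@ = -1 by exact: rmorphN1.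
rewrite /second_moment (_ : (fun w => _) = (fun w => h k i w * (h k i w)^@ +
  ((-1) * (h k i w * (he k i w)^@) + ((-1) * (h k i w * (he k i w)^@)^@ +
    he k i w * (he k i w)^@)))); last first.
  by apply/funext => w; rewrite -[- he k i w]mulN1r conjcD !conjcM conjc_invol cN1; ring.
have i1 := cintegrableZ (-1) ic.
have ic' := cintegrable_conjc ic.
have i2 := cintegrableZ (-1) ic'.
have i3 := cintegrableD i2 ie.
have i4 := cintegrableD i1 i3.
split; first exact: cintegrableD.
rewrite cexpectationD// cexpectationD// cexpectationD// !cexpectationZ//
  cexpectation_conjc//.
rewrite Eh Ec Ee conjc_real; rewrite -[in RHS]mulN1r realCD realCM.
rewrite [(-1)%:C](_ : _ = -1); first by ring.
by rewrite (rmorphN1 (real_complex R)).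
Qed.

(** A filter has nonzero mean only at its own index, so only the term a = k survives, where both
    filters are matched. *)
Lemma h_mean k : cintegrable P (h k (partner k)) /\
  E[h k (partner k)] = (n ^+ 2 * hf k * hg (partner k))%:C.
Proof.
have H a := indep_gen_cexpectationM (X := p k a) (Y := q (partner k) (partner a)) FG
  (let: And3 _ m _ := p_U k a (s := [:: 1; 3]%N) isT isT in m)
  (let: And3 _ m _ := q_U (partner k) (partner a) (s := [:: 0; 2]%N) isT isT in m)
  (cmoments_integrable (p_U k a (s := [:: 1; 3]%N) isT isT))
  (cmoments_integrable (q_U (partner k) (partner a) (s := [:: 0; 2]%N) isT isT)).
split; first by apply: cintegrable_sum => a _; exact: (H a).1.
rewrite cexpectation_sum; last by move=> a _; exact: (H a).1.
rewrite (bigD1 k)//= big1 ?addr0 => [|a ak]; rewrite (H _).2.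
  rewrite (cexpectation_filter_out var_ghat_ge0 var_eg_ge0 Ghat_law Eg_law GE) eqxx.
  rewrite (cexpectation_filter_out var_fhat_ge0 var_ef_ge0 Fhat_law Ef_law FE) eqxx.
  by rewrite -realCM; congr (_%:C); ring.
rewrite (cexpectation_filter_out var_fhat_ge0 var_ef_ge0 Fhat_law Ef_law FE).
by rewrite eq_sym (negbTE ak) mul0r.
Qed.

Lemma hE k i w :
  ((col k (F S w))^T *m W S w *m col i (G S w)) 0 0 = h k i w.
Proof.
rewrite mulmx_W_mulmx; apply: eq_bigr => a _.
by congr (_ * _); apply: eq_bigr => l _; rewrite !mxE.
Qed.

Lemma lambdaE k w : lambda S k w = h k k w - he k k w.
Proof.
rewrite /lambda hE; congr (_ - _); rewrite mulmx_W_mulmx; apply: eq_bigr => a _.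
by congr (_ * _); apply: eq_bigr => l _; rewrite !mxE.
Qed.

(** * Powers at the relay and at the users *)

Let Ghat_second a i : second_moment P (fun w => Ghat S w a i) (hg i).
Proof.
apply: (second_cmoments (Ghat_U (s := [:: 0]%N) _ _ _)) => //.
by rewrite (cexpectation_entry2 var_ghat_ge0 Ghat_law) !eqxx.
Qed.

Let fW k j w := ((col k (F S w))^T *m W S w) 0 j.

Let fWE k j : fW k j = fun w => \sum_a p k a w * (Ghat S w j (partner a))^@.
Proof.
apply/funext => w; rewrite /fW mulmx_W; apply: eq_bigr => a _.
by congr (_ * _); apply: eq_bigr => l _; rewrite !mxE.
Qed.

Let fW_U k j s : 0%N \in s -> 1%N \in s -> 3%N \in s -> cmoments P (U s) (fW k j).
Proof.
move=> s0 s1 s3; rewrite fWE.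
apply: cmoments_sum => // a _; apply: cmomentsM; first exact: p_U.
by apply: cmoments_conjc; exact: Ghat_U.
Qed.

Let fW_second k j : second_moment P (fW k j) (\sum_a VF k a * hg (partner a)).
Proof.
rewrite fWE.
apply: (bilin FG) => [a|a b|a|a].
- exact: p_U.
- exact: p2.
- by apply: cmoments_conjc; exact: Ghat_U.
- exact/second_moment_conjc/Ghat_second.
Qed.

Lemma norm2_fW k : has_mean P (fun w => norm2 ((col k (F S w))^T *m W S w))
  (n * \sum_a VF k a * hg (partner a)).
Proof.
have := @second_moment_norm2 _ _ _ P 1 N (fun w => (col k (F S w))^T *m W S w)
  (fun _ _ => \sum_a VF k a * hg (partner a)).
by rewrite !sum_ord_const mul1r; apply => i j; rewrite (ord1 i); exact: fW_second.
Qed.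

Let GRR2 a i b j : E[fun w => GRR S w a i * (GRR S w b j)^@] =
  if (a == b) && (i == j) then (var_LIR c)%:C else 0.
Proof. exact: (cexpectation_entry2 (fun=> var_LIR_ge0) GRR_law). Qed.

(** The entries of [A] may be correlated; a column of the self-loop channel is independent of them
    and uncorrelated, which suffices. *)
Let mul_GRR_second (A : T -> 'rV[R[i]]_N) j v :
  (forall l, cmoments P (U [:: 0; 1; 2; 3]%N) (fun w => A w 0 l)) ->
  (forall l, second_moment P (fun w => A w 0 l) v) ->
  second_moment P (fun w => (A w *m GRR S w) 0 j) (n * (var_LIR c * v)).
Proof.
move=> mA sA; rewrite (_ : (fun w => _) = (fun w => \sum_l GRR S w l j * A w 0 l));
  last first.
  by apply/funext => w; rewrite mxE; apply: eq_bigr => l _; rewrite mulrC.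
rewrite -sum_ord_const.
apply: (bilin (indepU (s := [:: 4]%N) (s' := [:: 0; 1; 2; 3]%N) _)) => [//|a|a b|//|//].
  exact: GRR_U.
by rewrite GRR2 eqxx andbT.
Qed.

Lemma norm2_fWG k : has_mean P (fun w => norm2 ((col k (F S w))^T *m W S w *m GRR S w))
  (n * (n * (var_LIR c * \sum_a VF k a * hg (partner a)))).
Proof.
have := @second_moment_norm2 _ _ _ P 1 N (fun w => (col k (F S w))^T *m W S w *m GRR S w)
  (fun _ _ => n * (var_LIR c * \sum_a VF k a * hg (partner a))).
rewrite !sum_ord_const mul1r; apply => i j; rewrite (ord1 i).
by apply: mul_GRR_second => l; [exact: fW_U|exact: fW_second].
Qed.

Let Fhatc2 j a b : E[fun w => (Fhat S w j a)^@ * ((Fhat S w j b)^@)^@] =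
  if a == b then (hf a)%:C else 0.
Proof.
rewrite (_ : (fun w => _) = (fun w => (Fhat S w j a)^@ * Fhat S w j b)); last first.
  by apply/funext => w; rewrite conjc_invol.
rewrite (cexpectation_conj_entry2 var_fhat_ge0 Fhat_law) eqxx/= eq_sym.
by case: eqP => [->|].
Qed.

Let Fhatc_U j a s : 1%N \in s -> cmoments P (U s) (fun w => (Fhat S w j a)^@).
Proof. by move=> s1; apply: cmoments_conjc; exact: Fhat_U. Qed.

Let WG l i w := (W S w *m G S w) l i.

Let WGE l i : WG l i = fun w => \sum_a (Fhat S w l a)^@ * q i (partner a) w.
Proof.
apply/funext => w; rewrite /WG mul_W; apply: eq_bigr => a _; congr (_ * _).
by apply: eq_bigr => j _; rewrite !mxE.
Qed.

Let WG_U l i s : 0%N \in s -> 1%N \in s -> 2%N \in s -> cmoments P (U s) (WG l i).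
Proof.
move=> s0 s1 s2; rewrite WGE.
by apply: cmoments_sum => // a _; apply: cmomentsM; [exact: Fhatc_U|exact: q_U].
Qed.

Let WG_second l i : second_moment P (WG l i) (\sum_a hf a * VG i (partner a)).
Proof.
rewrite WGE.
apply: (bilin (indepU (s := [:: 1]%N) (s' := [:: 0; 2]%N) _)) => [//|a|a b|a|a].
- exact: Fhatc_U.
- exact: Fhatc2.
- exact: q_U.
- exact: q_second.
Qed.

Let W_U l j s : 0%N \in s -> 1%N \in s -> cmoments P (U s) (fun w => W S w l j).
Proof.
move=> s0 s1; rewrite (_ : (fun w => _) = (fun w => \sum_a (Fhat S w l a)^@ * (Ghat S w
  j (partner a))^@)); last first.
  by apply/funext => w; exact: WE.
apply: cmoments_sum => // a _; apply: cmomentsM; first exact: Fhatc_U.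
by apply: cmoments_conjc; exact: Ghat_U.
Qed.

Let Ph := \sum_a hf a * hg (partner a).

Let W_second l j : second_moment P (fun w => W S w l j) Ph.
Proof.
rewrite (_ : (fun w => _) = (fun w => \sum_a (Fhat S w l a)^@ * (Ghat S w j (partner
  a))^@)); last first.
  by apply/funext => w; exact: WE.
apply: (bilin (indepU (s := [:: 1]%N) (s' := [:: 0]%N) _)) => [//|a|a b|a|a].
- exact: Fhatc_U.
- exact: Fhatc2.
- by apply: cmoments_conjc; exact: Ghat_U.
- exact/second_moment_conjc/Ghat_second.
Qed.

Lemma norm2_WGPx : has_mean P (fun w => norm2 (W S w *m G S w *m Pmx c *m xU S w))
  (n * \sum_i pow c i * \sum_a hf a * VG i (partner a)).
Proof.
have [ix Ex] := correlation_mx_uncorrelated xU_meas (oner_neq0 _) xU_corr.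
have := @second_moment_norm2 _ _ _ P N 1 (fun w => W S w *m G S w *m Pmx c *m xU S w)
  (fun _ _ => \sum_i 1 * (Num.sqrt (pow c i) ^+ 2 * \sum_a hf a * VG i (partner a))).
under [in X in has_mean _ _ X]eq_bigr do rewrite sum_ord_const.
rewrite sum_ord_const mul1r.
under [in X in has_mean _ _ X]eq_bigr do rewrite mul1r sqr_sqrtr//.
apply => l j; rewrite (ord1 j).
(* The data are put first to serve as the uncorrelated family; the columns of W G are correlated
   with one another. *)
rewrite (_ : (fun w => _) = (fun w => \sum_i xU S w i 0 * ((Num.sqrt (pow c i))%:C * WG
  l i w))); last first.
  apply/funext => w; rewrite mxE; apply: eq_bigr => i _.
  by rewrite /Pmx mul_mx_diag !mxE -/(WG l i w) mulrC [X in _ * X]mulrC /WG mxE.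
apply: (second_moment_bilinear (G := sigma_mx (xU S)) (H := U [:: 0; 1; 2]%N)) => //.
- apply: (@indep_gen_sub _ _ _ _ _ (U [:: 5]%N) _ (U [:: 0; 1; 2]%N)).
  + exact: (@blkU _ (@o 5 isT)).
  + by move=> A hA; exact: sub_sigma_algebra.
  + exact: indepU.
- by move=> a b; apply: cmeasM; [|apply: cmeas_conjc]; exact: cmeas_sigma_mx.
- by move=> a; apply: cmomentsM; [exact: cmoments_cst|exact: WG_U].
- by move=> a; apply: second_momentZ; exact: WG_second.
Qed.

Lemma norm2_WzR : has_mean P (fun w => norm2 (W S w *m zR S w))
  (n * (n * (var_nr c * Ph))).
Proof.
have := @second_moment_norm2 _ _ _ P N 1 (fun w => W S w *m zR S w)
  (fun _ _ => n * (var_nr c * Ph)).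
under [in X in has_mean _ _ X]eq_bigr do rewrite sum_ord_const.
rewrite sum_ord_const mul1r; apply => l j; rewrite (ord1 j).
rewrite (_ : (fun w => _) = (fun w => \sum_i zR S w i 0 * W S w l i)); last first.
  by apply/funext => w; rewrite mxE; apply: eq_bigr => i _; rewrite mulrC.
rewrite -sum_ord_const.
apply: (bilin (indepU (s := [:: 7]%N) (s' := [:: 0; 1]%N) _)) => [//|a|a b|a|a].
- exact: zR_U.
- by rewrite (cexpectation_entry2 (fun=> var_nr_ge0) zR_law) eqxx andbT.
- exact: W_U.
- exact: W_second.
Qed.

Lemma norm2_WGRRxR : has_mean P (fun w => norm2 (W S w *m GRR S w *m xR S w))
  (n * (n * (pow_R c / n * (n * (var_LIR c * Ph))))).
Proof.
have n0 : n != 0 by rewrite pnatr_eq0 -lt0n.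
have PRn0 : pow_R c / n != 0 by rewrite mulf_neq0 ?invr_eq0// gt_eqF.
have [ix Ex] := correlation_mx_uncorrelated (gaussian_vec_cmeasurable xR_law) PRn0
  xR_corr.
have := @second_moment_norm2 _ _ _ P N 1 (fun w => W S w *m GRR S w *m xR S w)
  (fun _ _ => n * (pow_R c / n * (n * (var_LIR c * Ph)))).
under [in X in has_mean _ _ X]eq_bigr do rewrite sum_ord_const.
rewrite sum_ord_const mul1r; apply => l j; rewrite (ord1 j).
rewrite (_ : (fun w => _) = (fun w => \sum_i xR S w i 0 * (W S w *m GRR S w) l i));
  last first.
  by apply/funext => w; rewrite mxE; apply: eq_bigr => i _; rewrite mulrC.
(* Only one row of W matters for entry l, so the row-vector lemma for the self-loop channel
   applies. *)
have rowE' w i : (W S w *m GRR S w) l i = (row l (W S w) *m GRR S w) 0 i.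
  by rewrite -row_mul [RHS]mxE.
rewrite -sum_ord_const.
apply: (second_moment_bilinear (G := sigma_mx (xR S)) (H := U [:: 0; 1; 4]%N)) => //.
- apply: (@indep_gen_sub _ _ _ _ _ (U [:: 6]%N) _ (U [:: 0; 1; 4]%N)).
  + exact: (@blkU _ (@o 6 isT)).
  + by move=> A hA; exact: sub_sigma_algebra.
  + exact: indepU.
- by move=> a b; apply: cmeasM; [|apply: cmeas_conjc]; exact: cmeas_sigma_mx.
- move=> a; rewrite (_ : (fun w => _) = (fun w => \sum_i W S w l i * GRR S w i a)).
    by apply: cmoments_sum => // i _; apply: cmomentsM; [exact: W_U|exact: GRR_U].
  by apply/funext => w; rewrite mxE.
- move=> a; rewrite (_ : (fun w => _) = (fun w => (row l (W S w) *m GRR S w) 0 a));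
  last first.
    by apply/funext => w; exact: rowE'.
  apply: mul_GRR_second => i.
  + rewrite (_ : (fun w => _) = (fun w => W S w l i)); first exact: W_U.
    by apply/funext => w; rewrite mxE.
  + rewrite (_ : (fun w => _) = (fun w => W S w l i)); first exact: W_second.
    by apply/funext => w; rewrite mxE.
Qed.

(* Both sides vanish when the total power is 0, since then x / 0 = 0. *)
Lemma alphaE : 1 / alpha P c S ^+ 2 =
  (n * (\sum_i pow c i * \sum_a hf a * VG i (partner a)) +
   n * (n * (pow_R c / n * (n * (var_LIR c * Ph)))) +
   n * (n * (var_nr c * Ph))) / pow_R c.
Proof.
have EE f v : has_mean P f v -> ('E_P[f] = v%:E)%E.
  move=> [fi <-]; rewrite fineK// unlock; exact: integrable_fin_num.
rewrite /alpha (EE _ _ norm2_WGPx) (EE _ _ norm2_WGRRxR) (EE _ _ norm2_WzR)/=.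
have Ege0 f v : (forall w, 0 <= f w) -> has_mean P f v -> 0 <= v.
  by move=> f0 fv; rewrite -lee_fin -(EE _ _ fv); exact: expectation_ge0.
have n2 m l (A : 'M[R[i]]_(m, l)) : 0 <= norm2 A.
  by apply: sumr_ge0 => i _; apply: sumr_ge0 => j _; exact: abs2_ge0.
rewrite sqr_sqrtr; first by rewrite div1r invf_div.
apply: divr_ge0; first exact: ltW.
by rewrite !addr_ge0//; [apply: (Ege0 _ _ _ norm2_WGPx)|apply: (Ege0 _ _ _ norm2_WGRRxR)|
  apply: (Ege0 _ _ _ norm2_WzR)] => w; exact: n2.
Qed.

(** * Closed forms of the moments *)

Let filterE s i a (v : 'I_(K.*2) -> R) : filter_second N v s i a =
  n * s * v a + (i == a)%:R * (n * v i) ^+ 2.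
Proof. by []. Qed.

Let PhE : Ph = Phi c.
Proof.
rewrite /Ph /Phi sum_users; apply: eq_bigr => m _.
by rewrite partner_fst partner_snd; ring.
Qed.

(** Common factor of [b2_] and [b3_]; [n * X i] is the second moment of each entry of W g_i. *)
Let X i := Phi c * sg i + n * hg i ^+ 2 * hf (partner i).

(** The last term, present only for i = k', is the squared mean of the useful coefficient;
    everything else is [b1_]. *)
Let sum_VFVG k i : \sum_a VF k a * VG i (partner a) =
  n ^+ 2 * b1_ c N k i + (i == partner k)%:R * (n ^+ 2 * hf k * hg i) ^+ 2.
Proof.
rewrite /VF /VG; under eq_bigr do rewrite !filterE.
rewrite (sum_users_delta hf hg (n * sf k) ((n * hf k) ^+ 2) (n * sg i) ((n * hg i) ^+
  2) k i).
by rewrite -/Ph PhE /b1_; ring.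
Qed.

Let sum_VFeVGe k : \sum_a VFe k a * VGe k (partner a) = - (n ^+ 2 * c_ c N k).
Proof.
rewrite /VFe /VGe; under eq_bigr do rewrite !filterE.
rewrite (sum_users_delta hf hg (n * hf k) ((n * hf k) ^+ 2) (n * hg k) ((n * hg k) ^+
  2) k k).
by rewrite -/Ph PhE /c_ [k == _]eq_sym (negbTE (partner_neq k)) !mul0r addr0; ring.
Qed.

Let sum_VF k : \sum_a VF k a * hg (partner a) =
  n * (sf k * Phi c + n * hf k ^+ 2 * hg (partner k)).
Proof.
(* Pad the plain factor with coefficients 1 and 0 to reach the shape of [sum_users_delta]. *)
rewrite (eq_bigr (fun a => (n * sf k * hf a + (k == a)%:R * (n * hf k) ^+ 2) *
  (1 * hg (partner a) + (k == partner a)%:R * 0))); last first.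
  by move=> a _; rewrite mulr0 addr0 mul1r.
rewrite (sum_users_delta hf hg (n * sf k) ((n * hf k) ^+ 2) 1 0 k k).
by rewrite -/Ph PhE; ring.
Qed.

Let sum_VG i : \sum_a hf a * VG i (partner a) = n * X i.
Proof.
rewrite (eq_bigr (fun a => (1 * hf a + (i == a)%:R * 0) *
  (n * sg i * hg (partner a) + (i == partner a)%:R * (n * hg i) ^+ 2))); last first.
  by move=> a _; rewrite mulr0 addr0 mul1r.
rewrite (sum_users_delta hf hg 1 0 (n * sg i) ((n * hg i) ^+ 2) i i).
by rewrite -/Ph PhE /X; ring.
Qed.

Let n0 : n != 0. Proof. by rewrite pnatr_eq0 -lt0n. Qed.
Let PR0 : pow_R c != 0. Proof. by rewrite gt_eqF. Qed.

Let S1 := \sum_i pow c i * X i.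

Lemma inv_alpha2 : 1 / alpha P c S ^+ 2 =
  n ^+ 2 * (S1 / pow_R c + var_LIR c * Phi c + var_nr c * Phi c / pow_R c).
Proof.
rewrite alphaE PhE (_ : \sum_i _ = n * S1); last first.
  by rewrite mulr_sumr; apply: eq_bigr => i _; rewrite sum_VG; ring.
by field; rewrite n0 PR0.
Qed.

Let SU k := \sum_(i | in_U k i) var_iui c k i * pow c i.

Let denom k := \sum_(i < K.*2)
      (b1_ c N k i + b2_ c N k i * (pow_R c)^-1 +
       \sum_(j | in_U k j) pow c j * (pow_R c)^-1 * b3_ c N k i j) * pow c i
   + c_ c N k * pow c k
   + (d1_ c N k + d2_ c N k * pow_R c + d3_ c k * (pow_R c)^-1)
   + \sum_(i | in_U k i) pow c i * f_ c k i (pow_R c).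

Let denomE k : denom k = \sum_i b1_ c N k i * pow c i +
   (var_n c + SU k) / pow_R c * S1 + c_ c N k * pow c k +
   (d1_ c N k + d2_ c N k * pow_R c + d3_ c k / pow_R c) +
   SU k * (var_nr c * Phi c / pow_R c + var_LIR c * Phi c).
Proof.
rewrite /denom; congr (_ + _ + _ + _).
  rewrite /S1 mulr_sumr -big_split/=; apply: eq_bigr => i _.
  rewrite (_ : \sum_(j | _) _ = SU k / pow_R c * X i).
    by rewrite /b2_ -/(X i); ring.
  rewrite /SU !mulr_suml; apply: eq_bigr => j _.
  by rewrite /b3_ -/(X i); ring.
rewrite /SU mulr_suml; apply: eq_bigr => i _.
by rewrite /f_ /e1_ /e2_; ring.
Qed.

(** * Mean of the SNR denominator *)

Let C0 := 1 / alpha P c S ^+ 2.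

Let D k w := pow c k * abs2 (lambda S k w)
   + \sum_(i | (i != k) && (i != partner k))
       pow c i * abs2 (((col k (F S w))^T *m W S w *m col i (G S w)) 0 0)
   + norm2 ((col k (F S w))^T *m W S w *m GRR S w) * (pow_R c / N%:R)
   + norm2 ((col k (F S w))^T *m W S w) * var_nr c
   + C0 * \sum_(i | in_U k i) var_iui c k i * pow c i
   + C0 * var_n c.

Let H k i := n ^+ 2 * b1_ c N k i + (i == partner k)%:R * (n ^+ 2 * hf k * hg i) ^+ 2.

Let H_mean k i : has_mean P (fun w => abs2 (h k i w)) (H k i).
Proof. by rewrite /H -sum_VFVG; apply: second_moment_abs2; exact: h_second. Qed.

Let om k := n * (sf k * Phi c + n * hf k ^+ 2 * hg (partner k)).

(** The factor of [pow c k] is the second moment of [lambda], as n^2 [c_] is minus that of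
    [he k k]. *)
Let DV k := pow c k * (H k k + n ^+ 2 * c_ c N k)
   + \sum_(i | (i != k) && (i != partner k)) pow c i * H k i
   + pow_R c / n * (n * (n * (var_LIR c * om k)))
   + var_nr c * (n * om k) + C0 * SU k + C0 * var_n c.

Let D_mean k : has_mean P (D k) (DV k).
Proof.
apply: has_meanD; last exact: has_mean_cst.
apply: has_meanD; last exact: has_mean_cst.
apply: has_meanD; last first.
  rewrite (_ : (fun w => _) = (fun w => var_nr c * norm2 ((col k (F S w))^T *m W S
    w))); last first.
    by apply/funext => w; rewrite mulrC.
  by apply: has_meanZ; rewrite /om -sum_VF; exact: norm2_fW.
apply: has_meanD; last first.
  rewrite (_ : (fun w => _) = (fun w => pow_R c / n * norm2 ((col k (F S w))^T *m W S w
    *m GRR S w))); last first.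
    by apply/funext => w; rewrite mulrC.
  by apply: has_meanZ; rewrite /om -sum_VF; exact: norm2_fWG.
apply: has_meanD.
  apply: has_meanZ; have := second_moment_abs2 (h_he_second k k).
  rewrite sum_VFVG sum_VFeVGe opprK; congr has_mean.
  by apply/funext => w; rewrite lambdaE.
apply: has_mean_sum => i _; apply: has_meanZ.
have := H_mean k i; congr has_mean.
by apply/funext => w; rewrite hE.
Qed.

Let m k := n ^+ 2 * hf k * hg (partner k).

(** Subtracting the squared mean cancels the spike of [H] at k' and leaves n^2 [b1_]: the variance
    of the useful coefficient acts as interference. This is why the sum in the claimed denominator
    runs over all i, including k and k'. *)
Lemma denom_identity k :
  pow c (partner k) * H k (partner k) + DV k - pow c (partner k) * m k ^+ 2 =
  n ^+ 2 * denom k.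
Proof.
rewrite denomE (bigD1 k)//= (bigD1 (partner k)) ?partner_neq//=.
rewrite /DV (_ : \sum_(i | _) pow c i * H k i =
  n ^+ 2 * \sum_(i | (i != k) && (i != partner k)) b1_ c N k i * pow c i); last first.
  rewrite mulr_sumr; apply: eq_bigr => i /andP[_ /negbTE ik].
  by rewrite /H ik mul0r addr0; ring.
set B := \sum_(i | _) _.
rewrite /H eqxx [k == _]eq_sym (negbTE (partner_neq k)) mul0r addr0 mul1r -/(m k).
rewrite /C0 inv_alpha2 /d1_ /d2_ /d3_ /om.
by field; rewrite n0 PR0.
Qed.

Let has_mean_ge (f : T -> R) r u : has_mean P f u -> (forall w, r <= f w) -> r <= u.
Proof.
move=> fu fr; have [_ E] := has_meanD fu (has_mean_cst P (- r)).
rewrite -subr_ge0 -E fine_ge0//; apply: expectation_ge0 => w.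
by rewrite subr_ge0.
Qed.

Let norm2_ge0 i j (A : 'M[R[i]]_(i, j)) : 0 <= norm2 A.
Proof. by apply: sumr_ge0 => ? _; apply: sumr_ge0 => ? _; exact: abs2_ge0. Qed.

Let C0_ge0 : 0 <= C0. Proof. by rewrite divr_ge0// sqr_ge0. Qed.

Ltac nonneg := do ?[exact: var_ghat_ge0|exact: var_fhat_ge0|exact: var_g_ge0|
  exact: var_f_ge0|exact: pow_ge0|exact: ler0n|exact: sqr_ge0|
  apply: addr_ge0|apply: mulr_ge0].

Lemma Phi_ge0 : 0 <= Phi c.
Proof. by apply: sumr_ge0 => i _; nonneg. Qed.

Let X_ge0 i : 0 <= X i.
Proof. by apply: addr_ge0; first (apply: mulr_ge0; first exact: Phi_ge0); nonneg. Qed.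

(** * Positivity and conclusion *)

Hypotheses (var_n_gt0 : 0 < var_n c)
  (var_iui_ge0 : forall k i, in_U k i -> 0 <= var_iui c k i).

Let D_ge k w : C0 * var_n c <= D k w.
Proof.
rewrite lerDr; apply: addr_ge0; [apply: addr_ge0; [apply: addr_ge0; [apply:
  addr_ge0|]|]|];
  [| |apply: mulr_ge0 => //..].
- by apply: mulr_ge0; last exact: abs2_ge0.
- by apply: sumr_ge0 => i _; apply: mulr_ge0; last exact: abs2_ge0.
- by apply: divr_ge0 => //; exact: ltW.
- by apply: sumr_ge0 => i Ui; apply: mulr_ge0; [exact: var_iui_ge0|].
Qed.

Let D_ge0 k w : 0 <= D k w.
Proof. by apply: le_trans (D_ge k w); rewrite mulr_ge0// ltW. Qed.

Let SNRE k w : SNR P c S k w = pow c (partner k) * abs2 (h k (partner k) w) / D k w.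
Proof. by rewrite /SNR hE. Qed.

(** The signal of user k' alone gives the relay output positive power, since X_{k'} is at least n
    times the square of [hg (partner k)] times [hf k]. *)
Let C0_gt0 k : a_ c N k * pow c (partner k) != 0 -> 0 < C0.
Proof.
move=> ap; have fk : hf k != 0.
  by apply: contraNneq ap => e; rewrite /a_ e expr0n mulr0 !mul0r.
have gk : hg (partner k) != 0.
  by apply: contraNneq ap => e; rewrite /a_ e expr0n mulr0 mul0r.
have pk : pow c (partner k) != 0 by apply: contraNneq ap => e; rewrite e mulr0.
have fk0 : 0 < hf k by rewrite lt_def fk var_fhat_ge0.
have gk0 : 0 < hg (partner k) by rewrite lt_def gk var_ghat_ge0.
have pk0 : 0 < pow c (partner k) by rewrite lt_def pk pow_ge0.
have ngt0 : 0 < n by rewrite ltr0n.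
have PRinv : 0 < (pow_R c)^-1 by rewrite invr_gt0.
rewrite /C0 inv_alpha2; apply: mulr_gt0; first exact: exprn_gt0.
apply: ltr_pwDl; last first.
  apply: mulr_ge0; last exact: ltW.
  by apply: mulr_ge0; last exact: Phi_ge0.
apply: ltr_pwDl; last by apply: mulr_ge0; last exact: Phi_ge0.
apply: mulr_gt0 => //; rewrite /S1 (bigD1 (partner k))//=.
apply: ltr_pwDl; last first.
  by apply: sumr_ge0 => i _; apply: mulr_ge0; last exact: X_ge0.
apply: mulr_gt0 => //; rewrite /X partnerK.
apply: ltr_wpDl; first by apply: mulr_ge0; [exact: Phi_ge0|exact: var_g_ge0].
by do 2?apply: mulr_gt0 => //; exact: exprn_gt0.
Qed.

Lemma rate_ge_SNR_mrc k :
  ((log2 (1 + SNR_mrc c N k))%:E <= ergodic_rate P c S k)%E.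
Proof.
(* In this case [C0], and with it [D], may vanish; the SNR stays nonnegative under the convention x
   / 0 = 0. *)
have [ap0|ap0] := eqVneq (a_ c N k * pow c (partner k)) 0.
  rewrite /SNR_mrc ap0 mul0r addr0 /log2 ln1 mul0r.
  apply: expectation_ge0 => w; rewrite divr_ge0 ?ln_ge0 ?ler1n// lerDl SNRE.
  by rewrite divr_ge0 ?mulr_ge0 ?abs2_ge0.
have C0p := C0_gt0 ap0.
have Dp w : 0 < D k w by apply: lt_le_trans (D_ge k w); rewrite mulr_gt0.
have [ih Eh] := h_mean k; have [ia Ea] := H_mean k (partner k).
have [iD ED] := D_mean k.
(* This is p Var h + E[D], where Var h = n^2 [b1_] is nonnegative and E[D] is at least
   [C0 * var_n c]. *)
have Qm : 0 < pow c (partner k) * H k (partner k) + DV k - pow c (partner k) * m k ^+ 2.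
  have DVp : 0 < DV k.
    have := has_mean_ge (D_mean k) (D_ge k); apply: lt_le_trans.
    by rewrite mulr_gt0.
  have : 0 <= pow c (partner k) * (n ^+ 2 * b1_ c N k (partner k)).
    by rewrite /b1_; have := Phi_ge0; move: (Phi c) => r r0; nonneg.
  rewrite /H eqxx mul1r -/(m k); lra.
have := @expectation_log2_ge _ _ _ P (h k (partner k)) (D k) (pow c (partner k)) (m k)
  (pow_ge0 _) Dp ih _ ia iD.
rewrite Eh Ea ED /= => /(_ erefl Qm).
rewrite denom_identity.
(* The factor n^2 cancels, as [a_] is m^2 / n^2. *)
have -> : pow c (partner k) * m k ^+ 2 / (n ^+ 2 * denom k) = SNR_mrc c N k.
  have dn0 : denom k != 0.
    by apply: contraTneq Qm => d0; rewrite denom_identity d0 mulr0 ltxx.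
  rewrite /SNR_mrc -/(denom k) /m /a_; field.
  by rewrite n0 dn0.
congr (_ <= 'E_P[_])%E; apply/funext => w; by rewrite SNRE.
Qed.

End relay.

Unset Implicit Arguments.

Theorem theorem1 (R : realType) (d : measure_display) (T : measurableType d)
    (P : probability T R) (K N : nat)
    (c : relay_params R K) (S : relay_rvs R K N T)
    (K_ge1 : (1 <= K)%N) (N_ge1 : (1 <= N)%N)
    (pow_ge0 : forall k, 0 <= pow c k)
    (pow_R_gt0 : 0 < pow_R c)
    (var_g_ge0 : forall k, 0 <= var_g c k)
    (var_f_ge0 : forall k, 0 <= var_f c k)
    (var_LIR_ge0 : 0 <= var_LIR c)
    (var_iui_ge0 : forall k i, in_U k i -> 0 <= var_iui c k i)
    (var_nr_ge0 : 0 <= var_nr c)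
    (var_n_gt0 : 0 < var_n c)
    (tau_ge : (2 * K <= tau c)%N)
    (pow_rho_gt0 : 0 < pow_rho c)
    (Ghat_law : cgaussian_mx P (Ghat S) (var_ghat c))
    (Fhat_law : cgaussian_mx P (Fhat S) (var_fhat c))
    (Eg_law : cgaussian_mx P (Eg S) (var_eg c))
    (Ef_law : cgaussian_mx P (Ef S) (var_ef c))
    (GRR_law : cgaussian_mx P (GRR S) (fun _ => var_LIR c))
    (xU_meas : cmeasurable_mx (xU S))
    (xU_corr : correlation_mx P (xU S) = 1%:M)
    (xR_law : gaussian_vec P (xR S))
    (xR_corr : correlation_mx P (xR S) = (pow_R c / N%:R)%:C%:M)
    (zR_law : cgaussian_mx P (zR S) (fun _ => var_nr c))
    (indep : mutual_indep P (tnth [tuple sigma_mx (Ghat S); sigma_mx (Fhat S);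
       sigma_mx (Eg S); sigma_mx (Ef S); sigma_mx (GRR S);
       sigma_mx (xU S); sigma_mx (xR S); sigma_mx (zR S)]))
    (k : 'I_(K.*2)) :
  ((log2 (1 + SNR_mrc c N k))%:E <= ergodic_rate P c S k)%E.
Proof.
exact: (rate_ge_SNR_mrc N_ge1 pow_ge0 pow_R_gt0 var_g_ge0 var_f_ge0 var_LIR_ge0
  var_nr_ge0 pow_rho_gt0 Ghat_law Fhat_law Eg_law Ef_law GRR_law xU_meas xU_corr
  xR_law xR_corr zR_law indep var_n_gt0 var_iui_ge0).
Qed.
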